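(* Let $f,g_1,\dots,g_m\in\mathbb{R}[x_1,\dots,x_n]$ and suppose there is $M>0$ such that $\|\mathbf{x}\|_\infty<M$ for all $\mathbf{x}$ in $\mathbf{K}=\{\mathbf{x}\in\mathbb{R}^n:g_1(\mathbf{x})\ge0,\dots,g_m(\mathbf{x})\ge0\}$. Let $I_1,\dots,I_p$ be the maximal cliques of a chordal extension of the csp graph of the problem $\rho^*=\inf\{f(\mathbf{x}):\mathbf{x}\in\mathbf{K}\}$, let $n_l=|I_l|$, and add to the description of $\mathbf{K}$ the redundant constraints $g_{m+l}(\mathbf{x}):=n_lM^2-\sum_{i\in I_l}x_i^2\ge0$, $l=1,\dots,p$. Consider the CS-TSSOS hierarchy for the problem with constraint polynomials $g_1,\dots,g_{m'}$, $m'=m+p$, and assume that the maximal chordal extension (the one completing every connected component to a complete graph) is used in the construction of the graphs $G_{d,l,j}^{(k)}=(F_{d,l,j}^{(k)})'$. Then for every $d\ge d_{\min}$ the sequence $(\rho_d^{(k)})_{k\ge1}$ of optimal values of $(\mathrm{Q}^{\mathrm{cs\text{-}ts}}_{d,k})$ converges in finitely many steps to the optimal value $\rho_d$ of $(\mathrm{Q}^{\mathrm{cs}}_d)$, and $(\rho_d)_{d\ge d_{\min}}$ converges to the global optimum $\rho^*$ as $d\to\infty$.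
   Context: Notation. $\mathbb{N}=\{0,1,2,\dots\}$, $[m]=\{1,\dots,m\}$, $\mathbb{N}^n_d=\{\boldsymbol\alpha\in\mathbb{N}^n:\sum_i\alpha_i\le d\}$, $(2\mathbb{N})^n=\{2\boldsymbol\alpha:\boldsymbol\alpha\in\mathbb{N}^n\}$. For a polynomial $h=\sum h_{\boldsymbol\alpha}\mathbf{x}^{\boldsymbol\alpha}$, $\mathrm{supp}(h)=\{\boldsymbol\alpha:h_{\boldsymbol\alpha}\ne0\}$; for an exponent $\boldsymbol\alpha$, $\mathrm{supp}(\boldsymbol\alpha)=\{i:\alpha_i\neq0\}$; $\mathrm{var}(h)$ is the set of (indices of) variables occurring in $h$. Sums of sets of exponents are Minkowski sums. Set $g_0=1$, $d_0=0$, $d_j=\lceil\deg(g_j)/2\rceil$, $d_{\min}=\max\{\lceil\deg(f)/2\rceil,d_1,\dots,d_{m'}\}$. Graphs. Graphs are undirected without loops. A chordal extension of $G$ is a chordal graph on the same nodes containing $G$; the maximal chordal extension makes every connected component of $G$ a complete subgraph. $G'$ denotes the chosen chordal extension of $G$. For $G$ with $V(G)\subseteq\mathbb{N}^n$, $\mathrm{supp}(G)=\{\boldsymbol\beta+\boldsymbol\gamma:\boldsymbol\beta=\boldsymbol\gamma\in V(G)\text{ or }\{\boldsymbol\beta,\boldsymbol\gamma\}\in E(G)\}$. $B_G$ is the adjacency matrix with ones on the diagonal; $\circ$ is the Hadamard product; $\mathbf{S}_+^r$ is the cone of $r\times r$ PSD matrices; $\Pi_G(Q)$ keeps the diagonal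 entries and the entries of $Q$ indexed by edges of $G$ and sets the others to zero; $\Pi_G(\mathbf{S}_+^{|V|})=\{\Pi_G(Q):Q\in\mathbf{S}_+^{|V|}\}$. Correlative sparsity. The csp graph (of $f,g_1,\dots,g_m$) has nodes $[n]$ and an edge $\{i,j\}$, $i\ne j$, if some $\boldsymbol\alpha\in\mathrm{supp}(f)$ has $\alpha_i,\alpha_j>0$, or $x_i,x_j\in\mathrm{var}(g_k)$ for some $k\in[m]$. $I_1,\dots,I_p$ are the maximal cliques of a fixed chordal extension of it, and $J_1,\dots,J_p$ are pairwise disjoint with union $[m']$ such that $\mathrm{var}(g_j)\subseteq I_l$ for $j\in J_l$. $\mathbb{N}^{n_l}$ is identified with $\{\boldsymbol\alpha\in\mathbb{N}^n:\mathrm{supp}(\boldsymbol\alpha)\subseteq I_l\}$, and $\mathbb{N}^{n_l}_d$ accordingly. Moment data. For a real sequence $\mathbf{y}=(y_{\boldsymbol\alpha})_{\boldsymbol\alpha\in\mathbb{N}^n}$, $L_{\mathbf{y}}(\sum h_{\boldsymbol\alpha}\mathbf{x}^{\boldsymbol\alpha})=\sum h_{\boldsymbol\alpha}y_{\boldsymbol\alpha}$. For $g\in\mathbb{R}[\mathbf{x}(I_l)]$ (polynomials in the variables $x_i$, $i\in I_l$), $M_d(g\mathbf{y},I_l)$ is the matrix indexed by $\mathbb{N}^{n_l}_d$ with entries $L_{\mathbf{y}}(g\,\mathbf{x}^{\boldsymbol\beta}\mathbf{x}^{\boldsymbol\gamma})$, and $M_d(\mathbf{y},I_l)=M_d(1\cdot\mathbf{y},I_l)$.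 The relaxation $(\mathrm{Q}^{\mathrm{cs}}_d)$ is: $\rho_d=\inf L_{\mathbf{y}}(f)$ s.t. $M_d(\mathbf{y},I_l)\succeq0$ and $M_{d-d_j}(g_j\mathbf{y},I_l)\succeq0$ for all $l\in[p]$, $j\in J_l$, and $y_{\mathbf{0}}=1$. Term sparsity. Let $\mathscr{A}=\mathrm{supp}(f)\cup\bigcup_{j=1}^{m'}\mathrm{supp}(g_j)$ and $\mathscr{A}_l=\{\boldsymbol\alpha\in\mathscr{A}:\mathrm{supp}(\boldsymbol\alpha)\subseteq I_l\}$. Let $V_{d,l,j}=\mathbb{N}^{n_l}_{d-d_j}$ for $j\in\{0\}\cup J_l$. $G_{d,l,0}^{(0)}$ is the graph on $V_{d,l,0}$ with edges $\{\boldsymbol\beta,\boldsymbol\gamma\}$, $\boldsymbol\beta\neq\boldsymbol\gamma$, $\boldsymbol\beta+\boldsymbol\gamma\in\mathscr{A}_l\cup(2\mathbb{N})^n$; for $j\in J_l$, $G_{d,l,j}^{(0)}$ is the edgeless graph on $V_{d,l,j}$. For $k\ge0$ set $\mathscr{C}_d^{(k)}=\bigcup_{l=1}^p\bigcup_{j\in\{0\}\cup J_l}(\mathrm{supp}(g_j)+\mathrm{supp}(G_{d,l,j}^{(k)}))$. For $k\ge1$, $F_{d,l,j}^{(k)}$ is the graph on $V_{d,l,j}$ with edges $\{\boldsymbol\beta,\boldsymbol\gamma\}$, $\boldsymbol\beta\ne\boldsymbol\gamma$, such that $(\boldsymbol\beta+\boldsymbol\gamma+\mathrm{supp}(g_j))\cap\mathscr{C}_d^{(k-1)}\neq\emptyset$,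 and $G_{d,l,j}^{(k)}=(F_{d,l,j}^{(k)})'$. The CS-TSSOS relaxation $(\mathrm{Q}^{\mathrm{cs\text{-}ts}}_{d,k})$ is: $\rho_d^{(k)}=\inf L_{\mathbf{y}}(f)$ s.t. $B_{G_{d,l,j}^{(k)}}\circ M_{d-d_j}(g_j\mathbf{y},I_l)\in\Pi_{G_{d,l,j}^{(k)}}(\mathbf{S}_+^{r_{l,j}})$ for all $l\in[p]$, $j\in\{0\}\cup J_l$, and $y_{\mathbf{0}}=1$, where $r_{l,j}=\binom{n_l+d-d_j}{d-d_j}$. Optimal values are in $[-\infty,+\infty]$. *)

(* Defs.v *)
From HB Require Import structures.
From mathcomp Require Import all_boot all_order all_algebra.
(* mpoly has to be imported before mathcomp-analysis: in the other order their
   notations clash. *)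
From mathcomp Require Import mpoly.
From mathcomp Require Import all_classical all_reals all_analysis.

Set Implicit Arguments.
Unset Strict Implicit.
Unset Printing Implicit Defensive.

Import Order.TTheory GRing.Theory Num.Theory.
Import numFieldNormedType.Exports.

Local Open Scope classical_set_scope.
Local Open Scope ring_scope.

(* A graph on a finite node type T is given by its adjacency relation e : rel T. *)

Section Graphs.
Variable T : finType.
Implicit Types (e : rel T) (A : {set T}).

Definition simple_graph e : Prop := ssrbool.symmetric e /\ irreflexive e.

(* every cycle of length at least 4 has a chord, i.e. an edge joining two of
   its nodes that are not consecutive on it *)
Definition chordal e : Prop :=
  forall c : seq T, (4 <= size c)%N -> ucycle e c ->
  exists x y, [/\ x \in c, y \in c, e x y, next c x != y & next c y != x].

Definition chordal_extension e e' : Prop :=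
  [/\ simple_graph e', chordal e' & subrel e e'].

Definition clique e : pred {set T} := fun A =>
  [forall x in A, forall y in A, (x != y) ==> e x y].

Definition max_clique e A : Prop := maxset (clique e) A.

(* [connect e] is the reflexive transitive closure of e, so that this graph
   makes every connected component of e complete. *)
Definition max_chordal_ext e : rel T :=
  [rel x y | (x != y) && connect e x y].

(* Rows and columns are indexed by the nodes through [enum_val]. *)
Definition adj_mx (R : realType) e : 'M[R]_#|T| :=
  \matrix_(i, j) ((i == j) || e (enum_val i) (enum_val j))%:R.

Definition graph_proj (R : realType) e (Q : 'M[R]_#|T|) : 'M[R]_#|T| :=
  \matrix_(i, j) if (i == j) || e (enum_val i) (enum_val j) then Q i j else 0.

End Graphs.

Definition hadamard (R : realType) r (A B : 'M[R]_r) : 'M[R]_r :=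
  map2_mx *%R A B.

Definition psd_cone (R : realType) r : set 'M[R]_r :=
  [set Q | Q^T = Q /\ forall v : 'rV[R]_r, 0 <= (v *m Q *m v^T) 0 0].

Section Polynomials.
Variables (R : realType) (n : nat).
Implicit Types (h : {mpoly R[n]}) (a : 'X_{1..n}) (I : {set 'I_n}).

Definition mon_supp a : {set 'I_n} := [set i | a i != 0%N]%SET.

Definition pol_supp h : set 'X_{1..n} := [set` msupp h].

Definition vars h : {set 'I_n} := (\bigcup_(a <- msupp h) mon_supp a)%SET.

(* ceil (deg h / 2); [msize h] is deg h + 1, and the zero polynomial is given
   degree 0 *)
Definition half_deg h : nat := uphalf (msize h).-1.

Definition minkowski_sum (A B : set 'X_{1..n}) : set 'X_{1..n} :=
  [set (a + b)%MM | a in A & b in B].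

Definition even_mons : set 'X_{1..n} := [set a | forall i, ~~ odd (a i)].

(* exponents of degree at most e whose support is contained in I *)
Definition mons I (e : nat) : finType :=
  {b : 'X_{1..n < e.+1} | mon_supp b \subset I}.

Definition mon_val I e (b : mons I e) : 'X_{1..n} := val b.

Definition graph_supp I e (E : rel (mons I e)) : set 'X_{1..n} :=
  [set a | exists b c, (b = c \/ E b c) /\ a = (mon_val b + mon_val c)%MM].

Definition riesz (y : 'X_{1..n} -> R) h : R :=
  \sum_(a <- msupp h) h@_a * y a.

(* M_e(h y, I) *)
Definition moment_mx e h (y : 'X_{1..n} -> R) I : 'M[R]_#|mons I e| :=
  \matrix_(i, j)
    riesz y (h * 'X_[mon_val (enum_val i)] * 'X_[mon_val (enum_val j)]).

Definition feasible_set m (g : 'I_m -> {mpoly R[n]}) : set 'rV[R]_n :=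
  [set x | forall k, 0 <= (g k).@[x 0]].

Definition global_opt m (f : {mpoly R[n]}) (g : 'I_m -> {mpoly R[n]}) : \bar R :=
  ereal_inf [set (f.@[x 0])%:E | x in feasible_set g].

Definition csp_graph m (f : {mpoly R[n]}) (g : 'I_m -> {mpoly R[n]}) : rel 'I_n :=
  [rel i j | (i != j) &&
    (has (fun a => (0 < a i)%N && (0 < a j)%N) (msupp f)
     || [exists k, (i \in vars (g k)) && (j \in vars (g k))])].

Definition enum_max_cliques p (e : rel 'I_n) (I : 'I_p -> {set 'I_n}) : Prop :=
  injective I /\ forall A, max_clique e A <-> exists l, A = I l.

Definition constraint_assignment p m (I : 'I_p -> {set 'I_n})
    (g : 'I_m -> {mpoly R[n]}) (J : 'I_p -> {set 'I_m}) : Prop :=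
  [/\ forall l l', l != l' -> [disjoint J l & J l']%B,
      forall j, exists l, j \in J l &
      forall l j, j \in J l -> vars (g j) \subset I l].

(* g_1, .., g_m followed by n_l M^2 - sum_(i in I_l) x_i^2, l = 1, .., p *)
Definition add_ball_constraints m p (g : 'I_m -> {mpoly R[n]})
    (I : 'I_p -> {set 'I_n}) (M : R) (j : 'I_(m + p)) : {mpoly R[n]} :=
  match fintype.split j with
  | inl k => g k
  | inr l => (#|I l|%:R * M ^+ 2)%:MP - \sum_(i in I l) 'X_i ^+ 2
  end.

Definition d_min m (f : {mpoly R[n]}) (g : 'I_m -> {mpoly R[n]}) : nat :=
  maxn (half_deg f) (\max_(j < m) half_deg (g j)).

End Polynomials.

Section Relaxations.
Variables (R : realType) (n m p : nat).
Variables (f : {mpoly R[n]}) (g : 'I_m -> {mpoly R[n]}).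
Variables (I : 'I_p -> {set 'I_n}) (J : 'I_p -> {set 'I_m}).

Definition cs_feasible (d : nat) : set ('X_{1..n} -> R) :=
  [set y | [/\ forall l, psd_cone (moment_mx d 1 y (I l)),
               forall l j, j \in J l ->
                 psd_cone (moment_mx (d - half_deg (g j)) (g j) y (I l)) &
               y 0%MM = 1]].

Definition cs_opt (d : nat) : \bar R :=
  ereal_inf [set (riesz y f)%:E | y in cs_feasible d].

(* The index set {0} \cup [m] is encoded as [option 'I_m], with [None] for 0
   and g_0 = 1 (hence d_0 = 0). *)
Definition g_ (j : option 'I_m) : {mpoly R[n]} := oapp g 1 j.

Definition J_ (l : 'I_p) : pred (option 'I_m) := oapp (mem (J l)) true.

Definition ts_nodes (d : nat) (l : 'I_p) (j : option 'I_m) : finType :=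
  mons (I l) (d - half_deg (g_ j)).

Definition ts_graphs (d : nat) : Type :=
  forall (l : 'I_p) (j : option 'I_m), rel (ts_nodes d l j).

Definition all_supp : set 'X_{1..n} :=
  pol_supp f `|` \bigcup_(j in [set: 'I_m]) pol_supp (g j).

Definition clique_supp (l : 'I_p) : set 'X_{1..n} :=
  [set a | all_supp a /\ mon_supp a \subset I l].

Definition init_graph (d : nat) : ts_graphs d := fun l j b c =>
  if j is Some _ then false
  else (b != c) &&
    `[< (clique_supp l `|` @even_mons n) (mon_val b + mon_val c)%MM >].

Definition joint_supp (d : nat) (G : ts_graphs d) : set 'X_{1..n} :=
  \bigcup_(l in [set: 'I_p]) \bigcup_(j in [set j | J_ l j])
    minkowski_sum (pol_supp (g_ j)) (graph_supp (G l j)).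

Definition supp_extension (d : nat) (G : ts_graphs d) : ts_graphs d :=
  fun l j b c =>
    (b != c) &&
    `[< minkowski_sum [set (mon_val b + mon_val c)%MM] (pol_supp (g_ j))
          `&` joint_supp G !=set0 >].

Fixpoint ts_graph (d k : nat) : ts_graphs d :=
  if k is k'.+1 then
    fun l j => max_chordal_ext (@supp_extension d (@ts_graph d k') l j)
  else @init_graph d.

Definition csts_feasible (d k : nat) : set ('X_{1..n} -> R) :=
  [set y | (forall l j, J_ l j ->
              let G := @ts_graph d k l j in
              let A := hadamard (adj_mx R G)
                         (moment_mx (d - half_deg (g_ j)) (g_ j) y (I l)) in
              (graph_proj G @` @psd_cone R _) A)
           /\ y 0%MM = 1].

Definition csts_opt (d k : nat) : \bar R :=
  ereal_inf [set (riesz y f)%:E | y in csts_feasible d k].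

End Relaxations.

(* Main.v *)
(* The graphs G^(k) increase with k, hence stabilize.  At a stable step, setting to
   zero the moments outside the joint support turns the masked moment matrices
   into genuine ones, and these are positive semidefinite because projecting on a
   disjoint union of complete graphs only keeps diagonal blocks.

   For the limit in d, the bounds are at most the global optimum by point
   evaluations.  Conversely let f - c be positive on K.  By induction on the
   vertex set, splitting a chordal graph along a clique separator, f - c is a sum
   of polynomials h_C, each in the variables of a clique C and positive on the set
   cut out by the constraints attached to C: across a separator S the two halves
   are rebalanced by a polynomial in the variables of S, an approximate minimum of
   finitely many penalized polynomials.  Putinar's Positivstellensatz, in Jacobi's
   form for archimedean quadratic modules, then represents each h_C by weighted
   squares, on which every feasible moment sequence of high order is
   nonnegative. *)

Require Import Defs.
From HB Require Import structures.
From mathcomp Require Import all_boot all_order all_algebra.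
From mathcomp Require Import finmap mpoly.
From mathcomp Require Import all_classical all_reals all_analysis.
From mathcomp Require Import zify ring lra.

Set Implicit Arguments.
Unset Strict Implicit.
Unset Printing Implicit Defensive.

Import Order.TTheory GRing.Theory Num.Theory.
Import numFieldNormedType.Exports.

Local Open Scope classical_set_scope.
Local Open Scope ring_scope.

(** * Putinar's Positivstellensatz *)

Section QuadraticModules.
Variables (R : realType) (n : nat).
Local Notation poly := {mpoly R[n]}.
Implicit Types (S T : set poly) (p q s : poly) (c : R).

Definition quad_module S : Prop :=
  [/\ S 1, forall p q, S p -> S q -> S (p + q) &
      forall s p, S p -> S (s ^+ 2 * p)].

Definition archi_module S : Prop := forall p, exists N : R, S (N%:MP - p).

Inductive sos : poly -> Prop :=
| sos_nil : sos 0
| sos_cons s p : sos p -> sos (s ^+ 2 + p).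

Lemma sosD p q : sos p -> sos q -> sos (p + q).
Proof.
by move=> sp sq; elim: sp => [|s r _ IH]; rewrite ?add0r// -addrA; constructor.
Qed.

Lemma sos_sqrM s p : sos p -> sos (s ^+ 2 * p).
Proof.
elim=> [|t q _ IH]; first by rewrite mulr0; constructor.
by rewrite mulrDr -exprMn; constructor.
Qed.

Lemma sos_sqr s : sos (s ^+ 2).
Proof. by rewrite -[_ ^+ 2]addr0; do 2 constructor. Qed.

Section Theory.
Variable S : set poly.
Hypothesis qS : quad_module S.

Lemma qm1 : S 1. Proof. by case: qS. Qed.

Lemma qmD p q : S p -> S q -> S (p + q).
Proof. by case: qS => _ + _; exact. Qed.

Lemma qm_sqrM s p : S p -> S (s ^+ 2 * p).
Proof. by case: qS => _ _; exact. Qed.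

Lemma qm_scale c p : 0 <= c -> S p -> S (c%:MP * p).
Proof.
move=> c0 Sp; rewrite -(sqr_sqrtr c0) rmorphXn /=.
exact: qm_sqrM.
Qed.

Lemma qm_const c : 0 <= c -> S c%:MP.
Proof. by move=> c0; rewrite -[_%:MP]mulr1; apply: qm_scale => //; exact: qm1. Qed.

Lemma qm_unscale c p : 0 < c -> S (c%:MP * p) -> S p.
Proof.
move=> c0 Sp; have -> : p = c^-1%:MP * (c%:MP * p).
  by rewrite mulrA -mpolyCM mulVf ?gt_eqF// mul1r.
by apply: qm_scale => //; rewrite invr_ge0 ltW.
Qed.

Lemma qm0 : S 0. Proof. by rewrite -mpolyC0; exact: qm_const. Qed.

Lemma qm_sqr s : S (s ^+ 2).
Proof. by rewrite -[_ ^+ 2]mulr1; exact/qm_sqrM/qm1. Qed.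

Lemma qm_sosM s p : sos s -> S p -> S (s * p).
Proof.
move=> + Sp; elim=> [|t q _ IH]; first by rewrite mul0r; exact: qm0.
by rewrite mulrDl; apply: qmD => //; exact: qm_sqrM.
Qed.

Lemma qm_sos s : sos s -> S s.
Proof. by move=> ss; rewrite -[s]mulr1; apply: qm_sosM => //; exact: qm1. Qed.

Lemma qm_le c d p : c <= d -> S (c%:MP + p) -> S (d%:MP + p).
Proof.
move=> cd Sp; have -> : d%:MP + p = (d - c)%:MP + (c%:MP + p) by ring.
by apply: qmD => //; apply: qm_const; rewrite subr_ge0.
Qed.

(* A quadratic module is not closed under products, but c - p and c + p have
   a product in it: multiply each of them by the square of the other. *)
Lemma qm_sqr_bound c p :
  0 < c -> S (c%:MP + p) -> S (c%:MP - p) -> S ((c ^+ 2)%:MP - p ^+ 2).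
Proof.
move=> c0 Sp Sn; apply: (@qm_unscale (2%:R * c)); first by rewrite mulr_gt0.
have -> : (2%:R * c)%:MP * ((c ^+ 2)%:MP - p ^+ 2) =
  (c%:MP - p) ^+ 2 * (c%:MP + p) + (c%:MP + p) ^+ 2 * (c%:MP - p) by ring.
by apply: qmD; apply: qm_sqrM.
Qed.

Lemma qm_bound_sqr c p :
  0 < c -> S ((c ^+ 2)%:MP - p ^+ 2) -> S (c%:MP - p).
Proof.
move=> c0 Sp; apply: (@qm_unscale (2%:R * c)); first by rewrite mulr_gt0.
have -> : (2%:R * c)%:MP * (c%:MP - p) =
  (c%:MP - p) ^+ 2 + ((c ^+ 2)%:MP - p ^+ 2) by ring.
by apply: qmD => //; exact: qm_sqr.
Qed.

(** Two-sided boundedness, unlike membership in [S], is stable under products: the bounded elements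
    form a subalgebra. *)
Definition qm_bounded p := exists c, [/\ 0 < c, S (c%:MP + p) & S (c%:MP - p)].

Lemma qm_boundedN p : qm_bounded p -> qm_bounded (- p).
Proof. by case=> c [c0 h1 h2]; exists c; split=> //; rewrite opprK. Qed.

Lemma qm_boundedD p q : qm_bounded p -> qm_bounded q -> qm_bounded (p + q).
Proof.
move=> [c [c0 h1 h2]] [d [d0 h3 h4]]; exists (c + d); split; first exact: addr_gt0.
  have -> : (c + d)%:MP + (p + q) = (c%:MP + p) + (d%:MP + q) by ring.
  exact: qmD.
have -> : (c + d)%:MP - (p + q) = (c%:MP - p) + (d%:MP - q) by ring.
exact: qmD.
Qed.

Lemma qm_boundedC c : qm_bounded c%:MP.
Proof.
exists (`|c| + 1); split; first by rewrite ltr_wpDl.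
  by rewrite -mpolyCD; apply: qm_const; have := ler_norm (- c); rewrite normrN; lra.
by rewrite -mpolyCB; apply: qm_const; have := ler_norm c; lra.
Qed.

Lemma qm_bounded_sqr p : qm_bounded p -> qm_bounded (p ^+ 2).
Proof.
move=> [c [c0 h1 h2]]; exists (c ^+ 2); split; first exact: exprn_gt0.
  by apply: qmD; [apply: qm_const; exact: sqr_ge0|exact: qm_sqr].
exact: qm_sqr_bound.
Qed.

Lemma qm_boundedZ c p : 0 < c -> qm_bounded p -> qm_bounded (c%:MP * p).
Proof.
move=> c0 [d [d0 h1 h2]]; exists (c * d); split; first exact: mulr_gt0.
  by rewrite mpolyCM -mulrDr; apply: qm_scale => //; exact: ltW.
by rewrite mpolyCM -mulrBr; apply: qm_scale => //; exact: ltW.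
Qed.

Lemma qm_boundedM p q : qm_bounded p -> qm_bounded q -> qm_bounded (p * q).
Proof.
move=> bp bq.
(* Polarization reduces a product to squares, the case of [qm_bounded_sqr]. *)
have -> : p * q = (4%:R^-1)%:MP * ((p + q) ^+ 2 - (p - q) ^+ 2).
  have -> : (p + q) ^+ 2 - (p - q) ^+ 2 = 4%:R%:MP * (p * q) by ring.
  by rewrite [RHS]mulrA -mpolyCM mulVf ?pnatr_eq0// mul1r.
apply: qm_boundedZ; first by rewrite invr_gt0.
apply: qm_boundedD; last apply: qm_boundedN; apply: qm_bounded_sqr.
  exact: qm_boundedD.
by apply: qm_boundedD => //; exact: qm_boundedN.
Qed.

(** A variable is bounded as soon as its square is, and the bounded elements form a subalgebra. *)
Lemma qm_archi :
  (forall i, exists N : R, S (N%:MP - 'X_i ^+ 2)) -> archi_module S.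
Proof.
move=> hX p; suff [c [_ _ Sc]] : qm_bounded p by exists c.
have bX i : qm_bounded 'X_i.
  have [N hN] := hX i.
  have hc : N <= (`|N| + 1) ^+ 2.
    have := ler_norm N; have := normr_ge0 N; set y := `|N|; nra.
  have hS := qm_le hc hN; have c0 : 0 < `|N| + 1 by rewrite ltr_wpDl.
  exists (`|N| + 1); split => //; last exact: qm_bound_sqr.
  by rewrite -[X in _ + X]opprK; apply: qm_bound_sqr; rewrite // sqrrN.
have bM m : qm_bounded 'X_[m].
  rewrite mpolyXE_id; elim/big_ind: _ => [||i _].
  - by rewrite -mpolyC1; exact: qm_boundedC.
  - exact: qm_boundedM.
  - elim: (m i) => [|k IH]; first by rewrite expr0 -mpolyC1; exact: qm_boundedC.
    by rewrite exprS; exact: qm_boundedM.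
elim/mpolyind: p => [|c m p _ _ bp]; first by rewrite -mpolyC0; exact: qm_boundedC.
apply: qm_boundedD => //; rewrite -mul_mpolyC; apply: qm_boundedM => //.
exact: qm_boundedC.
Qed.

(** For a quadratic module [S], the smallest quadratic module containing [S] and [a]. *)
Definition qm_adjoin a : set poly := [set p | exists s t, [/\ S s, sos t & p = s + t * a]].

Lemma qm_adjoin_quad_module a : quad_module (qm_adjoin a).
Proof.
split.
- by exists 1, 0; split; [exact: qm1|constructor|rewrite mul0r addr0].
- move=> _ _ [s [t [Ss st ->]]] [s' [t' [Ss' st' ->]]].
  exists (s + s'), (t + t'); split; [exact: qmD|exact: sosD|ring].
- move=> u _ [s [t [Ss st ->]]]; exists (u ^+ 2 * s), (u ^+ 2 * t).
  by split; [exact: qm_sqrM|exact: sos_sqrM|ring].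
Qed.

Lemma sub_qm_adjoin a : S `<=` qm_adjoin a.
Proof. by move=> p Sp; exists p, 0; split; [|constructor|rewrite mul0r addr0]. Qed.

Lemma mem_qm_adjoin a : qm_adjoin a a.
Proof.
by exists 0, (1 ^+ 2); split; [exact: qm0|exact: sos_sqr|rewrite expr1n mul1r add0r].
Qed.

(** Any multiplier is a difference of squares, [4 a = (a + 1)^2 - (a - 1)^2], and both signs of [p]
    are available. *)
Lemma qm_support_ideal p a : S p -> S (- p) -> sos p -> S (p * a).
Proof.
move=> Sp Snp sp; apply: (@qm_unscale 4%:R) => //.
have -> : 4%:R%:MP * (p * a) = (a + 1) ^+ 2 * p + (a - 1) ^+ 2 * - p by ring.
by apply: qmD; exact: qm_sqrM.
Qed.

(** If [a] and [-a] were both missing, adjoining either would give [-1 = s1 + t1 a = s2 - t2 a].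
    Eliminating [a] puts [-t1] in [S] next to [t1], so [t1 a] and finally [-1] lie in [S]. *)
Lemma qm_max_total :
  ~ S (-1) -> (forall T, quad_module T -> S `<=` T -> ~ T (-1) -> T `<=` S) ->
  forall a, S a \/ S (- a).
Proof.
move=> nS1 maxS a.
have adj b : ~ S b -> qm_adjoin b (-1).
  move=> nSb; apply: contrapT => nb; apply: nSb.
  apply: (maxS _ (qm_adjoin_quad_module b) (@sub_qm_adjoin b) nb).
  exact: mem_qm_adjoin.
case: (pselect (S a)) => [|na]; first by left.
case: (pselect (S (- a))) => [|nna]; first by right.
exfalso; have [s1 [t1 [Ss1 st1 e1]]] := adj _ na.
have [s2 [t2 [Ss2 st2 e2]]] := adj _ nna.
have St1 : S (- t1).
  have -> : - t1 = t2 + (t2 * s1 + t1 * s2).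
    have -> : - t1 = t1 * (s2 + t2 * - a) by rewrite -e2; ring.
    have : t2 * (1 + s1 + t1 * a) = 0 by rewrite -addrA -e1; ring.
    by move=> h; rewrite -[RHS](subr0) -h; ring.
  by apply: qmD; [exact: qm_sos|apply: qmD; exact: qm_sosM].
apply: nS1; rewrite e1; apply: qmD => //.
by apply: qm_support_ideal => //; exact: qm_sos.
Qed.

End Theory.

Lemma quad_module_max S : quad_module S -> ~ S (-1) ->
  exists T, [/\ quad_module T, S `<=` T, ~ T (-1) &
    forall U, quad_module U -> T `<=` U -> ~ U (-1) -> U `<=` T].
Proof.
move=> qS nS.
(* The union with [S] makes the property hold for the union of the empty chain too. *)
pose P (T : set poly) := quad_module (T `|` S) /\ ~ (T `|` S) (-1).
have [T [[qT nT] maxT]] : exists T, P T /\ forall U, T `<` U -> ~ P U.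
  apply: Zorn_bigcup => F FP Ftot; split; last first.
    by move=> [[T FT T1]|//]; have [_] := FP _ FT; apply; left.
  split; first by right; exact: qm1.
  - move=> p q [[T FT Tp]|Sp] [[U FU Uq]|Sq].
    + have [TU|UT] := Ftot _ _ FT FU.
        have [qU _] := FP _ FU.
        have [|?] := qmD qU (or_introl (TU _ Tp)) (or_introl Uq); last by right.
        by left; exists U.
      have [qT _] := FP _ FT.
      have [|?] := qmD qT (or_introl Tp) (or_introl (UT _ Uq)); last by right.
      by left; exists T.
    + have [qT _] := FP _ FT.
      have [|?] := qmD qT (or_introl Tp) (or_intror Sq); last by right.
      by left; exists T.
    + have [qU _] := FP _ FU.
      have [|?] := qmD qU (or_intror Sp) (or_introl Uq); last by right.
      by left; exists U.
    + by right; exact: qmD.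
  - move=> s p [[T FT Tp]|Sp]; last by right; exact: qm_sqrM.
    have [qT _] := FP _ FT.
    have [|?] := qm_sqrM qT s (or_introl Tp); last by right.
    by left; exists T.
exists (T `|` S); split=> // U qU TU nU.
apply: contrapT => UT; apply: (maxT U).
  split=> [p Tp|UT']; first by apply: TU; left.
  by apply: UT => p /UT' Tp; left.
by rewrite /P (_ : U `|` S = U)//; apply/setUidPl => p Sp; apply: TU; right.
Qed.

(** * Total archimedean quadratic modules and point evaluations *)

Section Evaluation.
Variable S : set poly.
Hypotheses (qS : quad_module S) (aS : archi_module S) (nS : ~ S (-1)).
Hypothesis totS : forall p, S p \/ S (- p).

Lemma qm_const_ge0 c : S c%:MP -> 0 <= c.
Proof.
move=> Sc; rewrite leNgt; apply/negP => c0; apply: nS.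
apply: (@qm_unscale _ qS (- c)); first by rewrite oppr_gt0.
by rewrite (_ : _ * _ = c%:MP)//; ring.
Qed.

Definition infinitesimal p := forall e, 0 < e -> S (e%:MP + p) /\ S (e%:MP - p).

Lemma infinitesimalN p : infinitesimal p -> infinitesimal (- p).
Proof. by move=> ip e /ip[? ?]; rewrite opprK. Qed.

Lemma infinitesimalD p q : infinitesimal p -> infinitesimal q -> infinitesimal (p + q).
Proof.
move=> ip iq e e0; have e2 : 0 < e / 2 by rewrite divr_gt0.
have [p1 p2] := ip _ e2; have [q1 q2] := iq _ e2.
have ee : e%:MP = (e / 2)%:MP + (e / 2)%:MP :> poly by rewrite -mpolyCD -splitr.
split; rewrite ee.
  by rewrite (_ : _ + _ = (e / 2)%:MP + p + ((e / 2)%:MP + q)); [exact: qmD|ring].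
by rewrite (_ : _ - _ = (e / 2)%:MP - p + ((e / 2)%:MP - q)); [exact: qmD|ring].
Qed.

Lemma infinitesimalZ c p : infinitesimal p -> infinitesimal (c%:MP * p).
Proof.
move=> ip; wlog c0 : c p ip / 0 < c.
  move=> hw; have [/hw|c0|<-] := ltgtP 0 c; first exact.
    have -> : c%:MP * p = (- c)%:MP * (- p) by ring.
    by apply: hw; [exact: infinitesimalN|rewrite oppr_gt0].
  by move=> e e0; rewrite mpolyC0 mul0r subr0 addr0; split; apply: qm_const => //; exact: ltW.
move=> e e0; have [p1 p2] := ip (e / c) (divr_gt0 e0 c0).
have ee : e%:MP = c%:MP * (e / c)%:MP :> poly.
  by rewrite -mpolyCM mulrC divfK// gt_eqF.
rewrite ee -mulrDr -mulrBr; split; apply: qm_scale => //; exact: ltW.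
Qed.

Lemma infinitesimal_sqr p : infinitesimal p -> infinitesimal (p ^+ 2).
Proof.
move=> ip e e0; split.
  by apply: qmD => //; [apply: qm_const => //; exact: ltW|exact: qm_sqr].
have s0 : 0 < Num.sqrt e by rewrite sqrtr_gt0.
have [h1 h2] := ip _ s0.
by have := qm_sqr_bound qS s0 h1 h2; rewrite sqr_sqrtr// ltW.
Qed.

Lemma infinitesimalM p q : infinitesimal p -> infinitesimal q -> infinitesimal (p * q).
Proof.
move=> ip iq.
have -> : p * q = (4%:R^-1)%:MP * ((p + q) ^+ 2 - (p - q) ^+ 2).
  have -> : (p + q) ^+ 2 - (p - q) ^+ 2 = 4%:R%:MP * (p * q) by ring.
  by rewrite [RHS]mulrA -mpolyCM mulVf ?pnatr_eq0// mul1r.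
apply/infinitesimalZ/infinitesimalD; last apply: infinitesimalN;
  apply: infinitesimal_sqr; apply: infinitesimalD => //.
exact: infinitesimalN.
Qed.

Lemma infinitesimal0 : infinitesimal 0.
Proof.
by move=> e e0; rewrite subr0 addr0; split; apply: qm_const => //; exact: ltW.
Qed.

(** The constant is the supremum of the reals [r] with [p - r] in [S]. The archimedean property
    bounds this set, and totality of [S] gives the upper estimate of [p]. *)
Lemma standard_part p : exists c, infinitesimal (p - c%:MP).
Proof.
pose E := [set r : R | S (p - r%:MP)].
have [N1 h1] := aS p; have [N2 h2] := aS (- p).
have supE : has_sup E.
  split; first by exists (- N2); rewrite /E/= -rmorphN/= opprK addrC -[p]opprK.
  exists N1 => r Er; rewrite -subr_ge0; apply: qm_const_ge0.
  by rewrite (_ : _%:MP = N1%:MP - p + (p - r%:MP)); [exact: qmD|ring].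
exists (sup E) => e e0; split.
  have [r Er re] := sup_adherent e0 supE.
  have -> : e%:MP + (p - (sup E)%:MP) = (e - sup E + r)%:MP + (p - r%:MP) by ring.
  by apply: qmD => //; apply: qm_const => //; lra.
have [h|h] := totS (e%:MP - (p - (sup E)%:MP)) => //.
have : E (sup E + e) by rewrite /E/= (_ : _ - _ = - (e%:MP - (p - (sup E)%:MP))); [|ring].
move=> /(ub_le_sup supE.2); lra.
Qed.

(** The point collects the standard parts of the variables; congruence modulo infinitesimals
    respects sums and products. *)
Lemma archi_total_eval : exists a : 'I_n -> R, forall p, infinitesimal (p - p.@[a]%:MP).
Proof.
have [a ha] := choice (fun i : 'I_n => standard_part 'X_i).
exists a => p.
have iM q r : infinitesimal (q - q.@[a]%:MP) -> infinitesimal (r - r.@[a]%:MP) ->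
    infinitesimal (q * r - (q * r).@[a]%:MP).
  move=> iq ir; rewrite mevalM.
  have -> : q * r - (q.@[a] * r.@[a])%:MP = (q - q.@[a]%:MP) * (r - r.@[a]%:MP) +
    (r.@[a]%:MP * (q - q.@[a]%:MP) + q.@[a]%:MP * (r - r.@[a]%:MP)) by ring.
  by apply/infinitesimalD/infinitesimalD;
    [exact: infinitesimalM|exact: infinitesimalZ|exact: infinitesimalZ].
have iC c : infinitesimal (c%:MP - (c%:MP).@[a]%:MP).
  by rewrite mevalC subrr; exact: infinitesimal0.
have iX m : infinitesimal ('X_[m] - ('X_[m]).@[a]%:MP).
  rewrite mpolyXE_id; elim/big_ind: _ => [||i _].
  - by rewrite -mpolyC1; exact: iC.
  - by move=> x y; exact: iM.
  - elim: (m i) => [|k IH]; first by rewrite expr0 -mpolyC1; exact: iC.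
    by rewrite exprS; apply: iM => //; rewrite mevalXU; exact: ha.
elim/mpolyind: p => [|c m p _ _ ip]; first by rewrite -mpolyC0; exact: iC.
rewrite mevalD; have -> : c *: 'X_[m] + p - ((c *: 'X_[m]).@[a] + p.@[a])%:MP =
  (c *: 'X_[m] - (c *: 'X_[m]).@[a]%:MP) + (p - p.@[a]%:MP) by ring.
by apply: infinitesimalD => //; rewrite -mul_mpolyC; exact: iM.
Qed.

End Evaluation.

(* If s h - 1 lies in S for a sum of squares s, then h + r can be lowered to
   h + r - 1/k for a fixed k, as long as r >= 0. *)
Lemma archi_descent S s h : quad_module S -> archi_module S -> sos s ->
  S (s * h - 1) -> S h.
Proof.
move=> qS aS ss Ssh.
have [k [k0 k1 k2]] : exists k, [/\ 0 < k, S (k%:MP - s ^+ 2 * h) & S ((2%:R * k)%:MP - s)].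
  have [N1 h1] := aS (s ^+ 2 * h); have [N2 h2] := aS s.
  exists (`|N1| + `|N2| + 1); have := ler_norm N1; have := ler_norm N2.
  have := normr_ge0 N1; have := normr_ge0 N2 => ? ? ? ?; split; first lra.
    by apply: qm_le h1 => //; lra.
  by apply: qm_le h2 => //; lra.
(* In [(k - s)^2 (r + h)] the terms other than [k^2 (r + h)] are compensated by nonnegative
   multiples of [s h - 1], [s (2k - s)] and [k - s^2 h], all in [S], at a total cost of [k]. *)
have step r : 0 <= r -> S (r%:MP + h) -> S ((r - k^-1)%:MP + h).
  move=> r0 Sr; apply: (@qm_unscale _ qS (k ^+ 2)); first exact: exprn_gt0.
  have kk : k%:MP * k^-1%:MP = 1 :> poly by rewrite -mpolyCM mulfV ?gt_eqF.
  have Ss2 : S (s * ((2%:R * k)%:MP - s)).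
    apply: (@qm_unscale _ qS (2%:R * k)); first by rewrite mulr_gt0.
    have -> : (2%:R * k)%:MP * (s * ((2%:R * k)%:MP - s)) =
      s ^+ 2 * ((2%:R * k)%:MP - s) + ((2%:R * k)%:MP - s) ^+ 2 * s by ring.
    by apply: qmD => //; apply: qm_sqrM => //; exact: qm_sos.
  have -> : (k ^+ 2)%:MP * ((r - k^-1)%:MP + h) =
     (k%:MP - s) ^+ 2 * (r%:MP + h) + ((2%:R * k)%:MP * (s * h - 1)
     + (r%:MP * (s * ((2%:R * k)%:MP - s)) + (k%:MP - s ^+ 2 * h))).
    rewrite rmorphB/= (_ : (k ^+ 2)%:MP * (_ - _ + _) =
      (k ^+ 2)%:MP * (r%:MP + h) - k%:MP * (k%:MP * k^-1%:MP)); last by ring.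
    by rewrite kk; ring.
  apply: qmD => //; first exact: qm_sqrM.
  apply: qmD => //; first by apply: qm_scale => //; lra.
  by apply: qmD => //; exact: qm_scale.
have [N hN] := aS (- h); rewrite opprK in hN.
(* The maximum with 0 maintains the condition [0 <= r] of [step]; it is reached once [j] exceeds
   [N k]. *)
have down j : S ((Num.max 0 (N - j%:R / k))%:MP + h).
  elim: j => [|j IH].
    by apply: qm_le hN => //; rewrite mul0r subr0 le_max lexx orbT.
  have r0 : 0 <= Num.max 0 (N - j%:R / k) by rewrite le_max lexx.
  apply: qm_le (step _ r0 IH) => //.
  have ki : 0 < k^-1 by rewrite invr_gt0.
  rewrite -natr1 mulrDl mul1r opprD addrA.
  set y := N - j%:R / k; set z := Num.max 0 (y - k^-1).
  have z0 : 0 <= z by rewrite le_max lexx.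
  have zy : y - k^-1 <= z by rewrite le_max lexx orbT.
  by rewrite lerBlDr ge_max; apply/andP; split; lra.
have [j hj] : exists j : nat, N * k < j%:R.
  by exists (Num.Def.truncn `|N * k|).+1; rewrite (le_lt_trans (ler_norm _))// truncnS_gt.
have := down j; rewrite (_ : Num.max _ _ = 0) ?mpolyC0 ?add0r//.
by apply/max_idPl; rewrite subr_le0 ler_pdivlMr// ltW.
Qed.

(** If adjoining [-h] produces [-1], then [s h - 1] lies in [S] for a sum of squares [s] and descent
    applies. Otherwise a maximal proper extension yields a point where [S] is nonnegative and [h] is
    at most 0. *)
Theorem putinar S h : quad_module S -> archi_module S ->
  (forall a : 'I_n -> R, (forall p, S p -> 0 <= p.@[a]) -> 0 < h.@[a]) -> S h.
Proof.
move=> qS aS hpos.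
have qT := qm_adjoin_quad_module qS (- h).
case: (pselect (qm_adjoin S (- h) (-1))) => [[m [s [Sm ss e]]]|nT].
  apply: (@archi_descent _ s) => //.
  by rewrite (_ : _ - 1 = m)// e; ring.
have [U [qU TU nU maxU]] := quad_module_max qT nT.
have SU : S `<=` U by move=> p Sp; apply: TU; exact: sub_qm_adjoin.
have aU : archi_module U by move=> p; have [N /SU] := aS p; exists N.
have [a ha] := archi_total_eval qU aU nU (qm_max_total qU nU maxU).
have evU p : U p -> 0 <= p.@[a].
  move=> Up; rewrite leNgt; apply/negP => pa.
  have e0 : 0 < - p.@[a] / 2 by rewrite divr_gt0// oppr_gt0.
  have [_ h2] := ha p _ e0.
  have /(qm_const_ge0 qU nU) : U (- p.@[a] / 2 + p.@[a])%:MP.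
    by rewrite (_ : _%:MP = p + ((- p.@[a] / 2)%:MP - (p - p.@[a]%:MP))); [exact: qmD|ring].
  lra.
have := hpos a (fun p Sp => evU _ (SU _ Sp)).
have := evU _ (TU _ (mem_qm_adjoin qS (- h))).
by rewrite mevalN oppr_ge0 => /le_lt_trans h1 /h1; rewrite ltxx.
Qed.

End QuadraticModules.

(** * Rebalancing positive polynomials across a separator *)

Section Variables.
Variables (R : realType) (n : nat).
Local Notation poly := {mpoly R[n]}.
Implicit Types (p q : poly) (A : {set 'I_n}) (m : 'X_{1..n}).

Lemma vars_subP p A :
  reflect (forall m, m \in msupp p -> mon_supp m \subset A) (vars p \subset A).
Proof.
apply: (iffP idP) => [h m mp|h].
  apply: fintype.subset_trans h; by rewrite /vars (big_rem m)//= finset.subsetUl.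
rewrite /vars big_seq; elim/big_ind: _ => //; first exact: finset.sub0set.
by move=> B C BA CA; rewrite finset.subUset BA.
Qed.

Lemma mon_suppD m m' : mon_supp (m + m')%MM = mon_supp m :|: mon_supp m'.
Proof. by apply/setP => i; rewrite !inE mnmDE addn_eq0 negb_and. Qed.

Lemma vars_subD p q A : vars p \subset A -> vars q \subset A -> vars (p + q) \subset A.
Proof.
move=> /vars_subP hp /vars_subP hq; apply/vars_subP => m /msuppD_le.
by rewrite mem_cat => /orP[/hp|/hq].
Qed.

Lemma vars_subM p q A : vars p \subset A -> vars q \subset A -> vars (p * q) \subset A.
Proof.
move=> /vars_subP hp /vars_subP hq; apply/vars_subP => m /msuppM_le.
by move=> /allpairsP; case=> -[m1 m2]/= [/hp h1 /hq h2 ->]; rewrite mon_suppD finset.subUset h1.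
Qed.

Lemma vars_subC (c : R) A : vars c%:MP_[n] \subset A.
Proof.
apply/vars_subP => m; rewrite msuppC; case: ifP => // _; rewrite inE => /eqP ->.
by apply/fintype.subsetP => i; rewrite inE mnm0E.
Qed.

Lemma vars_subN p A : vars p \subset A -> vars (- p) \subset A.
Proof. by move=> hp; rewrite -mulN1r -mpolyC1 -mpolyCN; apply/vars_subM/hp/vars_subC. Qed.

Lemma vars_subB p q A : vars p \subset A -> vars q \subset A -> vars (p - q) \subset A.
Proof. by move=> hp hq; apply/vars_subD/vars_subN. Qed.

Lemma vars_subX (i : 'I_n) A : i \in A -> vars ('X_i : poly) \subset A.
Proof.
move=> iA; apply/vars_subP => m; rewrite msuppX inE => /eqP ->.
apply/fintype.subsetP => j; rewrite inE mnm1E; by have [<-|] := eqVneq i j.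
Qed.

Lemma vars_subXn p k A : vars p \subset A -> vars (p ^+ k) \subset A.
Proof.
move=> hp; elim: k => [|k IH]; first by rewrite expr0 -mpolyC1 vars_subC.
by rewrite exprS vars_subM.
Qed.

Lemma vars_sub_sum (T : Type) (s : seq T) (P : pred T) (F : T -> poly) A :
  (forall i, P i -> vars (F i) \subset A) -> vars (\sum_(i <- s | P i) F i) \subset A.
Proof.
move=> h; elim/big_ind: _ => //; first by rewrite -mpolyC0 vars_subC.
by move=> ? ?; exact: vars_subD.
Qed.

Lemma meval_vars p A (u v : 'I_n -> R) : vars p \subset A ->
  (forall i, i \in A -> u i = v i) -> p.@[u] = p.@[v].
Proof.
move=> /vars_subP pA uv; rewrite !mevalE; apply: eq_big_seq => m /pA /fintype.subsetP mA.
congr (_ * _); apply: eq_bigr => i _; case: (eqVneq (m i) 0%N) => [->//|mi].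
by rewrite uv// mA// inE.
Qed.

Lemma meval_continuous p : continuous (fun x : 'rV[R]_n => p.@[x 0]).
Proof.
pose C q := continuous (fun x : 'rV[R]_n => q.@[x 0]).
have CC c : C c%:MP.
  rewrite /C (_ : (fun _ => _) = fun _ => c); first exact: cst_continuous.
  by apply/funext => x; rewrite mevalC.
have CM q r : C q -> C r -> C (q * r).
  move=> cq cr x.
  rewrite (_ : (fun _ => _) = (fun x : 'rV[R]_n => q.@[x 0]) \* (fun x : 'rV[R]_n => r.@[x 0])).
    exact: (cvgM (cq x) (cr x)).
  by apply/funext => y; rewrite mevalM.
have CD q r : C q -> C r -> C (q + r).
  move=> cq cr x.
  rewrite (_ : (fun _ => _) = (fun x : 'rV[R]_n => q.@[x 0]) \+ (fun x : 'rV[R]_n => r.@[x 0])).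
    exact: (cvgD (cq x) (cr x)).
  by apply/funext => y; rewrite mevalD.
have CX i : C 'X_i.
  rewrite /C (_ : (fun _ => _) = fun x : 'rV[R]_n => x 0 i); first exact: coord_continuous.
  by apply/funext => x; rewrite mevalXU.
have CXm m : C 'X_[m].
  rewrite mpolyXE_id; elim/big_ind: _ => [||i _]; [exact: CC|exact: CM|].
  by elim: (m i) => [|k IH]; rewrite ?expr0 ?exprS; [exact: CC|exact: CM].
elim/mpolyind: p => [|c m p _ _ cp]; first by rewrite -mpolyC0; exact: CC.
by apply: (CD _ _ _ cp); rewrite -mul_mpolyC; exact: CM.
Qed.

Lemma open_meval_gt0 p : open [set x : 'rV[R]_n | 0 < p.@[x 0]].
Proof.
have := @open_comp _ _ (fun x : 'rV[R]_n => p.@[x 0]) [set r | 0 < r].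
by apply; [move=> x _; exact: meval_continuous|exact: open_gt].
Qed.

Lemma closed_meval_ge0 p : closed [set x : 'rV[R]_n | 0 <= p.@[x 0]].
Proof.
have := @closed_comp _ _ (fun x : 'rV[R]_n => p.@[x 0]) [set r | 0 <= r].
by apply; [move=> x _; exact: meval_continuous|exact: closed_ge].
Qed.

(** * Polynomials on compact sets and their approximate minima *)

Definition box (N : R) : set 'rV[R]_n := [set x | forall i, `|x 0 i| <= N].

Lemma box_compact N : compact (box N).
Proof.
have := @rV_compact R^o n (fun _ => `[- N, N]%classic)
  (fun _ => @segment_compact R (- N) N).
congr compact; apply/seteqP; split => x /= h i; have := h i;
  by rewrite in_itv/= ler_norml.
Qed.

(** Finitely many of the open sets [F k > 0] cover [K], and by monotonicity the largest index serves
    everywhere. *)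
Lemma nat_compact_cover (K : set 'rV[R]_n) (F : nat -> poly) : compact K ->
  (forall k l, (k <= l)%N -> forall x, K x -> (F k).@[x 0] <= (F l).@[x 0]) ->
  (forall x, K x -> exists k, 0 < (F k).@[x 0]) ->
  exists k, forall x, K x -> 0 < (F k).@[x 0].
Proof.
rewrite compact_cover => cK Fmono Fpos.
have [||D _ KD] := cK nat setT (fun k => [set x | 0 < (F k).@[x 0]]).
- by move=> k _; exact: open_meval_gt0.
- by move=> x /Fpos[k k0]; exists k.
exists (\max_(k <- D) k)%N => x Kx; have [k /= kD k0] := KD _ Kx.
by apply: (lt_le_trans k0); apply: Fmono => //; exact: leq_bigmax_seq.
Qed.

Lemma compact_meval_pos (K : set 'rV[R]_n) p : compact K ->
  (forall x, K x -> 0 < p.@[x 0]) -> exists2 e, 0 < e & forall x, K x -> e <= p.@[x 0].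
Proof.
move=> cK ppos; case: (pselect (K !=set0)) => [K0|nK]; last first.
  by exists 1 => // x Kx; exfalso; apply: nK; exists x.
have cp : {within K, continuous (fun x : 'rV[R]_n => p.@[x 0])}.
  by apply: continuous_subspaceT => x; exact: meval_continuous.
have [c cKc hc] := EVT_min_rV K0 cK cp.
by exists p.@[c 0]; [apply/ppos/set_mem|move=> x Kx; apply/hc/mem_set].
Qed.

Lemma compact_meval_bounded (K : set 'rV[R]_n) p : compact K ->
  exists2 L, 0 < L & forall x, K x -> `|p.@[x 0]| <= L.
Proof.
move=> cK; case: (pselect (K !=set0)) => [K0|nK]; last first.
  by exists 1 => // x Kx; exfalso; apply: nK; exists x.
have cp : {within K, continuous (fun x : 'rV[R]_n => (p ^+ 2).@[x 0])}.
  by apply: continuous_subspaceT => x; exact: meval_continuous.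
have [c _ hc] := EVT_max_rV K0 cK cp.
(* Since [|z| <= 1 + z^2], a maximum of [p^2] bounds [|p|] without square roots. *)
exists (1 + (p ^+ 2).@[c 0]) => [|x Kx].
  by rewrite rmorphXn ltr_wpDr// sqr_ge0.
have := hc x (mem_set Kx); rewrite !rmorphXn -[_ ^+ 2]real_normK ?num_real//.
have := normr_ge0 p.@[x 0]; set y := `|p.@[x 0]|; set z := p.@[c 0] ^+ 2; nra.
Qed.

Lemma compact_penalty (K : set 'rV[R]_n) p q : compact K ->
  (forall x, K x -> 0 <= q.@[x 0]) ->
  (forall x, K x -> q.@[x 0] = 0 -> 0 < p.@[x 0]) ->
  exists C : R, forall x, K x -> 0 < (p + C%:MP * q).@[x 0].
Proof.
move=> cK q0 pq.
have [k l kl x Kx|x Kx|k hk] := @nat_compact_cover K (fun k => p + k%:R%:MP * q) cK.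
- rewrite !mevalD !mevalM !mevalC lerD2l ler_wpM2r ?q0// ler_nat//.
- have := q0 _ Kx; rewrite le_eqVlt => /orP[/eqP e|qx].
    by exists 0%N; rewrite mevalD mevalM -e mulr0 addr0; exact: pq.
  exists (Num.Def.truncn `|p.@[x 0] / q.@[x 0]|).+1.
  rewrite mevalD mevalM mevalC -ltrBlDl sub0r -ltr_pdivrMr//.
  apply: le_lt_trans (truncnS_gt _).
  by rewrite -normrN -mulNr ler_norm.
- by exists k%:R.
Qed.

(** The gap [D = t - y] becomes at most [D (1 - D / 2)], which turns the bound [2 / (J + 2)] into
    [2 / (J + 3)]. *)
Lemma abs_step (J t y : R) : 0 <= J -> t <= 1 -> 0 <= y -> y <= t ->
  (t - y) * (J + 2) <= 2 ->
  let y' := y + 2^-1 * (t ^+ 2 - y ^+ 2) in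
  [/\ 0 <= y', y' <= t & (t - y') * (J + 1 + 2) <= 2].
Proof.
move=> j0 t1 y0 yt h y'; rewrite {}/y'.
have P0 : 0 <= (t - y) * (t + y) by rewrite mulr_ge0; lra.
have P2 : (t - y) * (t + y) <= (t - y) * 2 by rewrite ler_wpM2l; lra.
have step : t - (y + 2^-1 * (t ^+ 2 - y ^+ 2)) <= (t - y) * (1 - (t - y) / 2).
  have : 0 <= (t - y) * y by rewrite mulr_ge0; lra.
  lra.
split; [lra|lra|].
apply: (@le_trans _ _ ((t - y) * (1 - (t - y) / 2) * (J + 1 + 2))).
  by rewrite ler_wpM2r//; lra.
have D0 : 0 <= t - y by lra.
move: h D0; set D := t - y; have : 2 <= J + 2 by lra.
rewrite (_ : J + 1 + 2 = J + 2 + 1); last by ring.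
clear -j0; move: (J + 2) D => a D a2 h D0.
(* Multiplying by [a^2] leaves an inequality between [x <= 2] and [a >= 2], which follows from
   [(a + 1) (2 - x) (a - 1 - x / 2) >= 0]. *)
set x := D * a in h; have x0 : 0 <= x by rewrite mulr_ge0//; lra.
have a20 : 0 < a ^+ 2 by rewrite exprn_gt0//; lra.
rewrite -(ler_pM2r a20).
have -> : D * (1 - D / 2) * (a + 1) * a ^+ 2 = x * (a - x / 2) * (a + 1).
  by rewrite /x; ring.
have : 0 <= (a + 1) * ((2 - x) * (a - 1 - x / 2)) by rewrite !mulr_ge0//; lra.
by nra.
Qed.

(* The iteration v <- v + (u^2 - v^2) / 2 started at 0 increases to |u|. *)
Lemma abs_approx (X : set 'rV[R]_n) (S : {set 'I_n}) p (e : R) : compact X ->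
  vars p \subset S -> 0 < e -> exists q, vars q \subset S /\
    forall x, X x -> `| `|p.@[x 0]| - q.@[x 0] | <= e.
Proof.
move=> cX pS e0; have [L L0 hL] := compact_meval_bounded p cX.
have [u uE] : exists u, u = L^-1%:MP * p by exists (L^-1%:MP * p).
have uS : vars u \subset S by rewrite uE vars_subM ?vars_subC.
have u1 x : X x -> `|u.@[x 0]| <= 1.
  move=> Xx; rewrite uE mevalM mevalC normrM gtr0_norm ?invr_gt0//.
  by rewrite ler_pdivrMl// mulr1 hL.
(* The error after [k] iterations is at most [2 / (k + 2)], and undoing the normalization multiplies
   it by [L]. *)
have [k hk] : exists k : nat, 2%:R * L / e < k%:R.
  exists (Num.Def.truncn `|2%:R * L / e|).+1.
  by rewrite (le_lt_trans (ler_norm _))// truncnS_gt.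
have approx k' : exists v, vars v \subset S /\ forall x, X x ->
    [/\ 0 <= v.@[x 0], v.@[x 0] <= `|u.@[x 0]| &
        (`|u.@[x 0]| - v.@[x 0]) * (k'%:R + 2) <= 2].
  elim: k' => [|j [v [vS hv]]].
    exists 0; split; first by rewrite -mpolyC0 vars_subC.
    by move=> x /u1; rewrite meval0 subr0 add0r => h; split => //; lra.
  exists (v + 2^-1%:MP * (u ^+ 2 - v ^+ 2)); split.
    by rewrite vars_subD// vars_subM ?vars_subC// vars_subB// vars_subXn.
  move=> x Xx; have [] := hv _ Xx; have := u1 _ Xx.
  rewrite mevalD mevalM mevalD mevalN !rmorphXn /= mevalC.
  have -> : u.@[x 0] ^+ 2 = `|u.@[x 0]| ^+ 2 by rewrite real_normK ?num_real.
  by rewrite -[j.+1%:R]natr1 => t1 y0 yt h; apply: abs_step.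
have [v [vS hv]] := approx k; exists (L%:MP * v).
split=> [|x Xx]; first by rewrite vars_subM ?vars_subC.
have [v0 vu hk2] := hv _ Xx.
have -> : `|p.@[x 0]| = L * `|u.@[x 0]|.
  by rewrite uE mevalM mevalC normrM gtr0_norm ?invr_gt0// mulrA divff ?mul1r// gt_eqF.
rewrite mevalM mevalC -mulrBr normrM gtr0_norm// ger0_norm ?subr_ge0//.
move: hk; rewrite ltr_pdivrMr// => hk.
have d0 : 0 <= `|u.@[x 0]| - v.@[x 0] by rewrite subr_ge0.
move: hk2 d0; set D := _ - _ => hk2 d0.
have k0 : 0 <= k%:R :> R by [].
rewrite -(@ler_pM2r _ (k%:R + 2)); last by lra.
have : L * (D * (k%:R + 2)) <= L * 2 by rewrite ler_pM2l.
nra.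
Qed.

(** Induction on the list through [min(p, q) = (p + q - |p - q|) / 2], with [abs_approx] for the
    absolute value; half of the error is left to the recursive call. *)
Lemma min_approx (X : set 'rV[R]_n) (S : {set 'I_n}) (s : seq poly) (e : R) : compact X ->
  s != [::] -> (forall p, p \in s -> vars p \subset S) -> 0 < e ->
  exists q, vars q \subset S /\ forall x, X x ->
    (forall p, p \in s -> q.@[x 0] <= p.@[x 0] + e) /\
    (exists2 p, p \in s & p.@[x 0] <= q.@[x 0] + e).
Proof.
move=> cX; elim: s e => // p s IH e _ sS e0.
have pS : vars p \subset S by apply: sS; rewrite mem_head.
have [->|s0] := eqVneq s [::].
  exists p; split => // x Xx; split; first by move=> q; rewrite inE => /eqP ->; lra.
  by exists p; [rewrite mem_head|lra].
have e20 : 0 < e / 2 by lra.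
have [q [qS hq]] := IH (e / 2) s0 (fun r rs => sS r (mem_behead (s := p :: s) rs)) e20.
have [a [aS ha]] := abs_approx cX (vars_subB pS qS) e20.
exists (2^-1%:MP * (p + q - a)); split.
  by rewrite vars_subM ?vars_subC// vars_subB// vars_subD.
move=> x Xx; have [h1 [p' p's h2]] := hq _ Xx; have := ha _ Xx.
rewrite mevalM mevalC !mevalD !mevalN ler_norml => /andP[a1 a2].
have [pq|pq] := lerP 0 (p.@[x 0] - q.@[x 0]).
  rewrite ger0_norm// in a1 a2; split=> [r|].
    rewrite inE => /orP[/eqP->|/h1]; lra.
  by exists p'; [rewrite inE p's orbT|lra].
rewrite ltr0_norm// in a1 a2; split=> [r|].
  rewrite inE => /orP[/eqP->|/h1]; lra.
by exists p; [rewrite mem_head|lra].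
Qed.

(** The box condition on [y] is separate because the coordinates of [y] outside [A] are
    arbitrary. *)
Definition determined_by A N (K : set 'rV[R]_n) :=
  forall x y : 'rV[R]_n, box N y -> (forall i, i \in A -> x 0 i = y 0 i) -> K x -> K y.

(* For z in KB the polynomial fB(z) + C |x_S - z_S|^2 - e in the variables of
   S = A :&: B lies above - fA on KA and below fB near z; finitely many of them
   suffice, and q approximates their minimum. *)
Lemma separate_pos (N : R) (A B : {set 'I_n}) (KA KB : set 'rV[R]_n) fA fB :
  closed KA -> KA `<=` box N -> determined_by A N KA ->
  closed KB -> KB `<=` box N -> determined_by B N KB ->
  vars fA \subset A -> vars fB \subset B ->
  (forall x, KA x -> KB x -> 0 < (fA + fB).@[x 0]) ->
  exists q, [/\ vars q \subset A :&: B, forall x, KA x -> 0 < (fA + q).@[x 0] &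
    forall x, KB x -> 0 < (fB - q).@[x 0]].
Proof.
move=> clA KAN dA clB KBN dB vA vB pos.
have cKA := subclosed_compact clA (@box_compact N) KAN.
have cKB := subclosed_compact clB (@box_compact N) KBN.
(* The second component [k] encodes a margin [1 / (k + 1)], which [fB - p] has to exceed on the
   covering set of the pair. *)
pose D := [set pk : poly * nat |
  vars pk.1 \subset A :&: B /\ forall x, KA x -> 0 < (fA + pk.1).@[x 0]].
have local z : KB z -> exists2 p, D (p, 0%N) & p.@[z 0] < fB.@[z 0].
  move=> KBz; pose q := \sum_(i in A :&: B) ('X_i - (z 0 i)%:MP) ^+ 2 : poly.
  have qE x : q.@[x 0] = \sum_(i in A :&: B) (x 0 i - z 0 i) ^+ 2.
    rewrite raddf_sum; apply: eq_bigr => i _.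
    by rewrite /= rmorphXn /= mevalD mevalN mevalXU mevalC.
  have qS : vars q \subset A :&: B.
    by apply: vars_sub_sum => i iS; rewrite vars_subXn// vars_subB ?vars_subX ?vars_subC.
  have [x KAx|x KAx|C hC] := @compact_penalty KA (fA + fB.@[z 0]%:MP) q cKA.
  - by rewrite qE sumr_ge0// => i _; exact: sqr_ge0.
  - rewrite qE => /eqP; rewrite psumr_eq0; last by move=> i _; exact: sqr_ge0.
    move=> /allP q0.
    have xz i : i \in A -> i \in B -> x 0 i = z 0 i.
      move=> iA iB; have := q0 i (mem_index_enum _); rewrite inE iA iB/=.
      by rewrite sqrf_eq0 subr_eq0 => /eqP.
    (* Where the penalty vanishes, [x] and [z] agree on [A :&: B] and glue to a point of both [KA]
       and [KB], at which [fA + fB] is positive. *)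
    pose w : 'rV[R]_n := \row_i (if i \in A then x 0 i else z 0 i).
    have wA i : i \in A -> x 0 i = w 0 i by rewrite mxE => ->.
    have wB i : i \in B -> z 0 i = w 0 i by rewrite mxE => iB; case: ifP => // iA; rewrite xz.
    have wN : box N w by move=> i; rewrite mxE; case: ifP => _; [exact: KAN|exact: KBN].
    have := pos w (dA _ _ wN wA KAx) (dB _ _ wN wB KBz).
    by rewrite !mevalD mevalC (meval_vars vA wA) (meval_vars vB wB).
  - have [e e0 he] := compact_meval_pos cKA hC.
    exists ((fB.@[z 0] - e / 2)%:MP + C%:MP * q).
      split=> /= [|x KAx]; first by rewrite vars_subD ?vars_subC// vars_subM ?vars_subC.
      by have := he _ KAx; rewrite !mevalD !mevalC; lra.
    rewrite mevalD mevalC mevalM qE big1 ?mulr0 ?addr0; last first.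
      by move=> i _; rewrite subrr expr0n.
    lra.
have := cKB; rewrite compact_cover => /(_ _ D
  (fun pk => [set x | 0 < (fB - pk.1 - (pk.2.+1%:R^-1)%:MP).@[x 0]]))[||F FD KF].
- by move=> pk _; exact: open_meval_gt0.
- move=> z /local[p [Dp1 Dp2] pz].
  exists (p, Num.Def.truncn (fB.@[z 0] - p.@[z 0])^-1); first by split.
  rewrite /= !mevalD !mevalN mevalC subr_gt0 invf_plt ?posrE ?subr_gt0//.
  exact: truncnS_gt.
have [L L0 hL] := compact_meval_bounded fA cKA.
(* The constant [L + 1] keeps the list nonempty even if the cover of [KB] is empty; it qualifies
   since [|fA| <= L] on [KA]. *)
pose s := (L + 1)%:MP :: [seq pk.1 | pk <- F].
pose k := (\max_(pk <- F) pk.2)%N.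
have sD p : p \in s -> vars p \subset A :&: B /\ forall x, KA x -> 0 < (fA + p).@[x 0].
  rewrite inE => /orP[/eqP ->|/mapP[pk /FD/set_mem Dpk ->]]; last exact: Dpk.
  split; first exact: vars_subC.
  by move=> x /hL; rewrite mevalD mevalC ler_norml; lra.
have [e e0 he] : exists2 e, 0 < e & forall p, p \in s -> forall x, KA x -> e <= (fA + p).@[x 0].
  elim: (s) sD => [|p t IH] tD; first by exists 1.
  have [e1 e10 h1] := compact_meval_pos cKA (tD p (mem_head _ _)).2.
  have [e2 e20 h2] := IH (fun p' pt => tD p' (mem_behead (s := p :: t) pt)).
  exists (Num.min e1 e2); first by rewrite lt_min e10.
  move=> r; rewrite inE => /orP[/eqP->|rt] x KAx; rewrite ge_min; first by rewrite h1.
  by rewrite (h2 r rt x KAx) orbT.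
have half_lt (a b : R) : 0 < a / 2 -> a <= b -> a / 2 < b by move=> *; lra.
(* An error below both the margin [e] on [KA] and the least margin [1 / (k + 1)] on [KB] spoils
   neither positivity. *)
pose eta := Num.min e k.+1%:R^-1 / 2.
have eta0 : 0 < eta by rewrite divr_gt0// lt_min e0 invr_gt0 ltr0n.
have [etae etak] : eta < e /\ eta < k.+1%:R^-1.
  move: eta0; rewrite /eta; set mm := Num.min _ _ => mm0.
  have : mm <= e by rewrite ge_min lexx.
  have : mm <= k.+1%:R^-1 by rewrite ge_min lexx orbT.
  by move=> h1 h2; split; apply: half_lt.
have [q [qS hq]] := min_approx (@box_compact N) (isT : s != [::]) (fun p ps => (sD p ps).1) eta0.
exists q; split => // x Kx.
  have [_ [p ps hp]] := hq _ (KAN _ Kx).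
  by have := he _ ps _ Kx; rewrite !mevalD; lra.
have [h1 _] := hq _ (KBN _ Kx); have [pk /= pkF /= hpk] := KF _ Kx.
have ps : pk.1 \in s by rewrite inE; apply/orP; right; apply: map_f.
have := h1 _ ps; move: hpk.
have : k.+1%:R^-1 <= pk.2.+1%:R^-1 :> R.
  by rewrite lef_pV2 ?posrE ?ltr0n// ler_nat ltnS; exact: (@leq_bigmax_seq _ _ xpredT (fun i : poly * nat => i.2)).
rewrite !mevalD !mevalN mevalC; move: etak.
move: (k.+1%:R^-1) (pk.2.+1%:R^-1) => u v *; lra.
Qed.

End Variables.

(** * Clique separators of chordal graphs *)

Section ChordalSplit.
Variable T : finType.
Implicit Types (e r : rel T) (A B C W : {set T}).

Lemma cliqueP e A :
  reflect (forall x y, x \in A -> y \in A -> x != y -> e x y) (clique e A).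
Proof.
apply: (iffP forall_inP) => [h x y xA yA|h x xA].
  by have /forall_inP/(_ _ yA)/implyP := h x xA.
by apply/forall_inP => y yA; apply/implyP; exact: h.
Qed.

Lemma last_take (x : T) p i : (i <= size p)%N -> last x (take i p) = nth x (x :: p) i.
Proof.
move=> ip; rewrite (last_nth x) size_takel//; case: i ip => //= i ip.
by rewrite nth_take.
Qed.

Lemma path_shortcut r x p i j : path r x p -> (i < j <= size p)%N ->
  r (nth x (x :: p) i) (nth x (x :: p) j) ->
  path r x (take i p ++ drop j.-1 p) /\ last x (take i p ++ drop j.-1 p) = last x p.
Proof.
move=> xp /andP[ij jp] rij; have j0 : (0 < j)%N by apply: leq_trans ij.
have ip : (i <= size p)%N by apply: leq_trans (ltnW ij) jp.
(* Positions are counted in [x :: p], hence the shift by one in [p]. *)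
have dropE : drop j.-1 p = nth x (x :: p) j :: drop j p.
  by case: j j0 jp {ij rij} => //= j _ jp; rewrite (drop_nth x).
have := xp; rewrite -{1}(cat_take_drop j p) cat_path (last_take x jp) => /andP[_ pj].
rewrite dropE cat_path (last_take x ip) /= rij pj take_path//; split => //.
by rewrite last_cat/= -(last_take x jp) -last_cat cat_take_drop.
Qed.

(** Removing the loops from a path of minimal length gives a simple path that is no longer. *)
Lemma shortest_path r x y : connect r x y -> exists p,
  [/\ path r x p, last x p = y, uniq (x :: p) & forall p', path r x p' -> last x p' = y ->
    (size p <= size p')%N].
Proof.
move=> /connectP[p0 xp0 yp0].
pose Q k := [exists p : k.-tuple T, path r x p && (last x p == y)].
have QE p : path r x p -> last x p = y -> Q (size p).
  by move=> xp yp; apply/existsP; exists (in_tuple p); rewrite xp yp eqxx.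
have Qex : exists k, Q k by exists (size p0); exact: QE.
case: (ex_minnP Qex) => k /existsP[p /andP[xp /eqP yp]] kmin.
have := size_tuple p; move: yp; case: (shortenP xp) => p' xp' up' sub yp' sp.
exists p'; split => // q xq yq; apply: leq_trans _ (kmin _ (QE _ xq yq)).
by rewrite -sp; apply: uniq_leq_size sub; case/andP: up'.
Qed.

Section Split.
Variables (e : rel T) (W : {set T}).
Hypotheses (esym : ssrbool.symmetric e) (eirr : irreflexive e).

Definition induced A : rel T := [rel u v | [&& u \in A, v \in A & e u v]].

Definition connected_in A := [forall x in A, forall y in A, connect (induced A) x y].

Definition closed_nbh A := [set y in W | (y \in A) || [exists x in A, e x y]].

Lemma connected_inP A :
  reflect {in A &, forall x y, connect (induced A) x y} (connected_in A).
Proof.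
apply: (iffP forall_inP) => [h x y xA yA|h x xA].
  by have /forall_inP := h x xA; apply.
by apply/forall_inP => y yA; exact: h.
Qed.

Lemma induced_mono A B : A \subset B -> subrel (connect (induced A)) (connect (induced B)).
Proof.
move=> AB; apply: connect_sub => x y /and3P[xA yA xy]; apply: connect1.
by rewrite /induced/= !(fintype.subsetP AB).
Qed.

Lemma induced_sym A : connect_sym (induced A).
Proof.
by apply: sym_connect_sym => x y; rewrite /induced/= esym; case: (x \in A); case: (y \in A).
Qed.

Lemma connected_in_setU1 A s x : connected_in A -> x \in A -> e x s ->
  connected_in (s |: A).
Proof.
move=> /connected_inP cA xA xs.
have AsA : A \subset s |: A by rewrite finset.subsetUr.
have key y : y \in s |: A -> connect (induced (s |: A)) x y.
  rewrite !inE => /orP[/eqP ->|yA].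
    by apply: connect1; rewrite /induced/= !inE eqxx xA orbT.
  exact: induced_mono (cA _ _ xA yA).
apply/connected_inP => y z ys zs; apply: connect_trans (key _ zs).
by rewrite induced_sym key.
Qed.

(* Two non-adjacent s, t in the neighbourhood of a connected set A with a
   common neighbour b at distance >= 2 from A: a shortest s-t path through A
   closes up with b to a chordless cycle. *)
Lemma chordal_nbh A s t b : chordal e -> connected_in A ->
  s \notin A -> t \notin A -> b \notin A -> {in A, forall x, ~~ e x b} ->
  (exists2 x, x \in A & e x s) -> (exists2 x, x \in A & e x t) ->
  e s b -> e t b -> s != t -> e s t.
Proof.
move=> ch cA sA tA bA nb [u uA us] [v vA vt] sb tb st; apply: contraT => nst.
pose D := s |: (t |: A).
have AD : A \subset D by rewrite /D finset.setUA finset.subsetUr.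
have DE x : x \in D = [|| x == s, x == t | x \in A] by rewrite !inE.
have /shortest_path[p [sp tp up pmin]] : connect (induced D) s t.
  apply: (@connect_trans _ _ u); first by
    apply: connect1; rewrite /induced/= !DE uA eqxx esym us !orbT.
  apply: (@connect_trans _ _ v); first exact: induced_mono (connected_inP _ cA _ _ uA vA).
  by apply: connect1; rewrite /induced/= !DE vA eqxx vt !orbT.
have pD : {subset s :: p <= D}.
  have {}sp : path (induced D) s p by [].
  move=> x; rewrite inE => /orP[/eqP ->|]; first by rewrite DE eqxx.
  by elim: p (s) sp {tp up pmin} => //= y p IH z /andP[/and3P[_ yD _] yp];
    rewrite inE => /orP[/eqP ->|/(IH _ yp)].
have bq : b \notin s :: p.
  apply/negP => /pD; rewrite DE (negPf bA) orbF => /orP[]/eqP be.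
    by rewrite be eirr in sb.
  by rewrite be eirr in tb.
have ep : path e s p by apply: sub_path sp => x y /and3P[].
(* As [s] and [t] are distinct and nonadjacent, the cycle through [b] has at least four nodes. *)
have size_p : (2 <= size p)%N.
  case: (p) tp ep => [/= ste|x [|//]/= -> /andP[ste]]; last by rewrite ste in nst.
  by rewrite ste eqxx in st.
pose c := b :: s :: p.
have cyc : ucycle e c.
  rewrite /ucycle /c cons_uniq bq up andbT /cycle rcons_cons /= (esym b) sb /=.
  by rewrite rcons_path ep tp tb.
have nextE x : x \in s :: p -> next c x = nth b (s :: p) (index x (s :: p)).+1.
  move=> xq; rewrite next_nth inE xq orbT [index _ (b :: _)]/=.
  by case: eqVneq => // bx; rewrite bx xq in bq.
have next_b : next c b = s by rewrite next_nth inE eqxx /= eqxx.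
have next_t : next c t = b.
  by rewrite nextE -tp ?mem_last// index_last// nth_default.
(* No chord leaves [b]: among the nodes of the cycle it can only be adjacent to [s] and [t], which
   are next to it there. *)
have tail x y : x = b -> y \in c -> e x y -> next c x != y -> next c y != x -> False.
  move=> -> ; rewrite inE => /orP[/eqP ->|yq]; first by rewrite eirr.
  have := pD _ yq; rewrite DE => /or3P[/eqP ->|/eqP ->|yA] ey.
  - by rewrite next_b eqxx.
  - by rewrite next_t eqxx.
  - by have := nb _ yA; rewrite esym ey.
(* A chord between two nodes of the path would shorten the path. *)
have inner x y : x \in s :: p -> y \in s :: p -> (index x (s :: p) < index y (s :: p))%N ->
    e x y -> next c x != y -> False.
  move=> xq yq ij exy; rewrite nextE//; set i := index x _ in ij *; set j := index y _ in ij *.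
  have jp : (j <= size p)%N by rewrite -ltnS -[(size p).+1]/(size (s :: p)) index_mem.
  have iE : nth s (s :: p) i = x by rewrite nth_index.
  have jE : nth s (s :: p) j = y by rewrite nth_index.
  move: ij; rewrite leq_eqVlt => /orP[/eqP ij|ij].
    by rewrite ij (set_nth_default s) ?jE ?eqxx// ltnS.
  have ij' : (i < j <= size p)%N by rewrite jp (ltnW ij).
  have [|sp' tp'] := path_shortcut sp ij'.
    by rewrite iE jE /induced/= !pD.
  have := pmin _ sp' (etrans tp' tp).
  rewrite size_cat size_takel ?size_drop; last by apply: leq_trans (ltnW (ltnW ij)) jp.
  by clear -ij jp; lia.
have [x [y [xc yc xy nx ny]]] := ch c size_p cyc.
have [xb|xb] := eqVneq x b; first by case: (tail x y).
have [yb|yb] := eqVneq y b; first by case: (tail y x); rewrite // esym.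
rewrite inE (negPf xb) in xc; rewrite inE (negPf yb) in yc.
have [ij|ij|ij] := ltngtP (index x (s :: p)) (index y (s :: p)).
- by case: (inner x y).
- by case: (inner y x); rewrite // esym.
- by move: xy; rewrite -(nth_index s xc) -(nth_index s yc) ij eirr.
Qed.

(** Let [A0] be maximal among the nonempty connected subsets of [W] whose closed neighbourhood
    misses some node of [W], and let [b] be missed. By maximality every boundary node of [A0] is
    adjacent to [b], so the boundary is a clique by [chordal_nbh], and it separates [A0] from the
    rest. *)
Lemma chordal_split : chordal e -> ~~ clique e W -> exists A B,
  [/\ A \proper W, B \proper W, A :|: B = W, clique e (A :&: B) &
    forall C, clique e C -> C \subset W -> (C \subset A) || (C \subset B)].
Proof.
move=> ch nW.
pose P A := [&& A \subset W, A != finset.set0, connected_in A & closed_nbh A != W].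
have [a Pa] : exists a, P [set a]%SET.
  move: nW; rewrite negb_forall_in => /exists_inP[a aW].
  rewrite negb_forall_in => /exists_inP[b bW]; rewrite negb_imply => /andP[ab nab].
  exists a; rewrite /P finset.sub1set aW /=; apply/and3P; split.
  - by apply/finset.set0Pn; exists a; rewrite inE.
  - by apply/connected_inP => x y; rewrite !inE => /eqP -> /eqP ->.
  - apply/eqP => /setP/(_ b); rewrite !inE bW/= eq_sym (negPf ab)/= => /existsP[x].
    by rewrite inE => /andP[/eqP ->]; exact/negP.
have [A0 /maxsetP[/and4P[A0W A0n cA0 nA0] maxA] _] := maxset_exists Pa.
have nbhW : closed_nbh A0 \subset W by apply/fintype.subsetP => x; rewrite inE => /andP[].
have A0nbh : A0 \subset closed_nbh A0.
  by apply/fintype.subsetP => x xA; rewrite inE xA (fintype.subsetP A0W).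
have [b bW bn] : exists2 b, b \in W & b \notin closed_nbh A0.
  by apply/subsetPn; move: nA0; rewrite finset.eqEsubset nbhW.
have bA0 : b \notin A0 by apply: contra bn => /(fintype.subsetP A0nbh).
have adj s : s \in closed_nbh A0 :&: (W :\: A0) ->
    [/\ s \notin A0, exists2 x, x \in A0 & e x s & e s b].
  rewrite !inE => /andP[/andP[sW sn] /andP[sA _]]; rewrite (negPf sA) /= in sn.
  have sx : exists2 x, x \in A0 & e x s by apply/exists_inP.
  split => //; have [x xA xs] := sx.
  have [/maxA h|] := boolP (P (s |: A0)).
    by move: sA; rewrite -(h _) ?inE ?eqxx// finset.subsetUr.
  rewrite /P finset.subUset finset.sub1set sW A0W (connected_in_setU1 cA0 xA xs)/=.
  rewrite (_ : _ != finset.set0); last by apply/finset.set0Pn; exists s; rewrite !inE eqxx.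
  rewrite negbK => /eqP/setP/(_ b); rewrite !inE bW/= (negPf bA0) orbF.
  case: eqVneq => [bs _|_ /= /exists_inP[y]].
    by move: bn; rewrite bs inE sW sn orbT.
  rewrite !inE => /orP[/eqP -> //|yA] yb.
  by move: bn; rewrite inE bW (negPf bA0)/=; case/negP; apply/exists_inP; exists y.
exists (closed_nbh A0), (W :\: A0); split.
- by rewrite properE nbhW; apply/subsetPn; exists b.
- rewrite properE finset.subsetDl; have /finset.set0Pn[x xA] := A0n.
  by apply/subsetPn; exists x; [exact: (fintype.subsetP A0W)|rewrite !inE xA].
- apply/setP => x; rewrite !inE; case: (x \in W); rewrite ?andbF//= andbT.
  by case: (x \in A0); rewrite ?orbT.
- apply/cliqueP => s t /adj[sA sx sb] /adj[tA tx tb] st.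
  apply: (@chordal_nbh A0 s t b) => // x xA; apply/negP => xb.
  by move: bn; rewrite inE bW; case/negP; apply/orP; right; apply/exists_inP; exists x.
- move=> C /cliqueP cC CW; have [|/subsetPn[x xC]] := boolP (C \subset W :\: A0).
    by rewrite orbT.
  rewrite !inE (fintype.subsetP CW _ xC) andbT negbK => xA; rewrite orbF.
  apply/fintype.subsetP => y yC; rewrite inE (fintype.subsetP CW _ yC)/=.
  have [->|xy] := eqVneq y x; first by rewrite xA.
  by apply/orP; right; apply/exists_inP; exists x => //; apply: cC; rewrite // eq_sym.
Qed.

End Split.
End ChordalSplit.

(** * Decomposition of positive sparse polynomials *)

Section SparsePositivity.
Variables (R : realType) (n : nat) (T : finType).
Local Notation poly := {mpoly R[n]}.
Variables (e : rel 'I_n) (N : R) (g : T -> poly) (O : T -> {set 'I_n}).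
Hypotheses (e_simple : simple_graph e) (e_chordal : chordal e).
Hypotheses (O_clique : forall j, clique e (O j)) (g_vars : forall j, vars (g j) \subset O j).
Implicit Types (A B C W : {set 'I_n}) (f h : poly).

(** [O j] is the clique to which constraint [j] is assigned. Asking for all of it in [W], and not
    only for the variables of [g j], makes each clique use only its own constraints. *)
Definition local_feasible W : set 'rV[R]_n :=
  [set x | box N x /\ forall j, O j \subset W -> 0 <= (g j).@[x 0]].

Lemma clique_subset A B : clique e A -> B \subset A -> clique e B.
Proof.
move=> /cliqueP cA /fintype.subsetP BA; apply/cliqueP => x y /BA xA /BA yA.
exact: cA.
Qed.

Lemma local_feasible_closed W : closed (local_feasible W).
Proof.
have -> : local_feasible W = box N `&`
    \bigcap_(j in [set j | O j \subset W]) [set x | 0 <= (g j).@[x 0]].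
  by apply/seteqP; split => x [bx hx]; split => // j; exact: hx.
apply: closedI.
  by apply: compact_closed; [exact: norm_hausdorff|exact: box_compact].
by apply: closed_bigI => j _; exact: closed_meval_ge0.
Qed.

Lemma local_feasible_determined W : determined_by W N (local_feasible W).
Proof.
move=> x y yN xy [xN hx]; split => // j OW.
rewrite -(@meval_vars _ _ _ _ (x 0) _ (g_vars j)) ?hx// => i iO.
exact/xy/(fintype.subsetP OW).
Qed.

Definition sparse_on W f :=
  forall m, m \in msupp f -> mon_supp m \subset W /\ clique e (mon_supp m).

Lemma sparse_onD W f h : sparse_on W f -> sparse_on W h -> sparse_on W (f + h).
Proof. by move=> sf sh m /msuppD_le; rewrite mem_cat => /orP[/sf|/sh]. Qed.

Lemma sparse_on_clique C W f : clique e C -> C \subset W -> vars f \subset C ->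
  sparse_on W f.
Proof.
move=> cC CW /vars_subP fC m /fC mC; split; last exact: clique_subset mC.
exact: fintype.subset_trans CW.
Qed.

Lemma sparse_on_part W f (Q : pred 'X_{1..n}) : sparse_on W f ->
  sparse_on W (\sum_(m <- msupp f | Q m) f@_m *: 'X_[m]).
Proof.
move=> sf; rewrite big_seq_cond; elim/big_ind: _ => [m|? ?|m /andP[mf _] m'].
- by rewrite msupp0.
- exact: sparse_onD.
- by move=> /msuppZ_le; rewrite msuppX inE => /eqP ->; exact: sf.
Qed.

(** [P] will be nonnegativity under feasible moment sequences of high order; the induction only uses
    that it is additive and holds on cliques. *)
Lemma sparse_positivity (P : poly -> Prop) :
  (forall h1 h2, P h1 -> P h2 -> P (h1 + h2)) ->
  (forall C h, clique e C -> vars h \subset C ->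
     (forall x, local_feasible C x -> 0 < h.@[x 0]) -> P h) ->
  forall W f, sparse_on W f ->
    (forall x, local_feasible W x -> 0 < f.@[x 0]) -> P f.
Proof.
move=> PD Pc W; have [k] := ubnP #|W|; elim: k W => // k IH W.
rewrite ltnS => Wk f sf fpos; have [cW|ncW] := boolP (clique e W).
  by apply: (Pc W) => //; apply/vars_subP => m /sf[].
have [A [B [AW BW ABW cAB cliques]]] := chordal_split e_simple.1 e_simple.2 e_chordal ncW.
(* The support of a monomial is a clique, so it lies in [A] or in [B]. *)
pose fA := \sum_(m <- msupp f | mon_supp m \subset A) f@_m *: 'X_[m] : poly.
pose fB := \sum_(m <- msupp f | ~~ (mon_supp m \subset A)) f@_m *: 'X_[m] : poly.
have fE : f = fA + fB by rewrite {1}[f]mpolyE (bigID (fun m => mon_supp m \subset A)).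
have part (Q : pred 'X_{1..n}) C : (forall m, m \in msupp f -> Q m -> mon_supp m \subset C) ->
    vars (\sum_(m <- msupp f | Q m) f@_m *: 'X_[m] : poly) \subset C.
  move=> QC; rewrite big_seq_cond; apply: vars_sub_sum => m /andP[mf Qm].
  apply/vars_subP => m' /msuppZ_le; rewrite msuppX inE => /eqP ->; exact: QC.
have vA : vars fA \subset A by apply: part.
have vB : vars fB \subset B.
  apply: part => m mf mA; have [mW mc] := sf _ mf.
  by have := cliques _ mc mW; rewrite (negPf mA).
have pos x : local_feasible A x -> local_feasible B x -> 0 < (fA + fB).@[x 0].
  move=> [xN hA] [_ hB]; rewrite -fE; apply: fpos; split => // j OW.
  by have /orP[/hA|/hB] := cliques _ (O_clique j) OW.
have [q [qAB qA qB]] := separate_pos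
  (@local_feasible_closed A) (fun x (h : local_feasible A x) => h.1) (@local_feasible_determined A)
  (@local_feasible_closed B) (fun x (h : local_feasible B x) => h.1) (@local_feasible_determined B)
  vA vB pos.
(* As [q] only involves the clique [A :&: B], both summands are again sparse, on smaller vertex
   sets. *)
have -> : f = (fA + q) + (fB - q) by rewrite fE; ring.
have sub C h : vars h \subset C -> sparse_on W h -> sparse_on C h.
  by move=> /vars_subP hC sh m mh; split; [exact: hC|have [] := sh _ mh].
apply: PD.
  apply: (IH A) => //; first exact: leq_trans (proper_card AW) Wk.
  apply: sparse_onD; first by apply: sub => //; exact: sparse_on_part.
  by apply: (sparse_on_clique cAB) => //; exact: finset.subsetIl.
apply: (IH B) => //; first exact: leq_trans (proper_card BW) Wk.
apply: sparse_onD; first by apply: sub => //; exact: sparse_on_part.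
by apply: (sparse_on_clique cAB); [exact: finset.subsetIr|exact: vars_subN].
Qed.

End SparsePositivity.

(** * Quadratic modules of cliques and moment matrices *)

Section Restriction.
Variables (R : realType) (n : nat).
Local Notation poly := {mpoly R[n]}.
Implicit Types (C : {set 'I_n}) (p q s : poly).

(** Substituting 0 outside [C] is a ring morphism that retracts all polynomials onto those in the
    variables of [C]. *)
Definition restr_vars C p : poly :=
  p \mPo [tuple if i \in C then 'X_i else 0 | i < n].

Lemma restr_varsD C p q : restr_vars C (p + q) = restr_vars C p + restr_vars C q.
Proof. exact: comp_mpolyD. Qed.

Lemma restr_varsM C p q : restr_vars C (p * q) = restr_vars C p * restr_vars C q.
Proof. by rewrite /restr_vars rmorphM. Qed.

Lemma restr_varsXU C i : restr_vars C 'X_i = if i \in C then 'X_i else 0.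
Proof. by rewrite /restr_vars comp_mpolyXU -tnth_nth tnth_mktuple. Qed.

Lemma restr_varsXm C m : restr_vars C 'X_[m] =
  \prod_(i < n) (if i \in C then 'X_i else 0) ^+ m i.
Proof.
by rewrite /restr_vars comp_mpolyX; apply: eq_bigr => i _; rewrite tnth_mktuple.
Qed.

Lemma restr_vars_sub C p : vars (restr_vars C p) \subset C.
Proof.
rewrite /restr_vars comp_mpolyEX; apply: vars_sub_sum => m _.
rewrite -mul_mpolyC vars_subM ?vars_subC//.
rewrite [X in vars X]restr_varsXm; elim/big_ind: _ => [||i _].
- by rewrite -mpolyC1 vars_subC.
- by move=> ? ?; exact: vars_subM.
- apply: vars_subXn; case: ifP => iC; first exact: vars_subX.
  by rewrite -mpolyC0 vars_subC.
Qed.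

Lemma restr_vars_id C p : vars p \subset C -> restr_vars C p = p.
Proof.
move=> /vars_subP pC; rewrite [RHS]mpolyE /restr_vars comp_mpolyEX.
apply: eq_big_seq => m /pC /fintype.subsetP mC; congr (_ *: _).
rewrite [LHS]restr_varsXm [RHS]mpolyXE_id; apply: eq_bigr => i _.
have [->|mi] := eqVneq (m i) 0%N; first by rewrite !expr0.
by rewrite mC// inE.
Qed.

End Restriction.

(** * Putinar's theorem in the variables of a clique *)

Section CliqueModule.
Variables (R : realType) (n k : nat) (g : 'I_k -> {mpoly R[n]}).
Variables (C : {set 'I_n}) (D : {set 'I_k}).
Local Notation poly := {mpoly R[n]}.

(** The multipliers are restricted to the variables of [C], and each constructor adds a single
    square, the form in which a moment matrix tests nonnegativity. *)
Inductive clique_qm : poly -> Prop :=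
| clique_qm0 : clique_qm 0
| clique_qm_sqr s q : vars s \subset C -> clique_qm q -> clique_qm (s ^+ 2 + q)
| clique_qm_gen j s q : j \in D -> vars s \subset C -> clique_qm q ->
    clique_qm (g j * s ^+ 2 + q).

Lemma clique_qmD p q : clique_qm p -> clique_qm q -> clique_qm (p + q).
Proof.
move=> + cq; elim=> [|s r sC _|j s r jD sC _]; first by rewrite add0r.
  by rewrite -addrA; constructor.
by rewrite -addrA; constructor.
Qed.

Lemma clique_qmM s p : vars s \subset C -> clique_qm p -> clique_qm (s ^+ 2 * p).
Proof.
move=> sC; elim=> [|t r tC _ IH|j t r jD tC _ IH]; first by rewrite mulr0; constructor.
  by rewrite mulrDr -exprMn; constructor => //; exact: vars_subM.
by rewrite mulrDr mulrCA -exprMn; constructor => //; exact: vars_subM.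
Qed.

(** Pulling back along [restr_vars] gives a quadratic module of the full polynomial ring, where
    [putinar] is stated. *)
Definition clique_module : set poly := [set p | clique_qm (restr_vars C p)].

Lemma clique_module_quad : quad_module clique_module.
Proof.
split.
- rewrite /clique_module/= /restr_vars rmorph1 -[1]addr0 -(expr1n _ 2).
  by constructor; [rewrite -mpolyC1 vars_subC|constructor].
- by move=> p q; rewrite /clique_module/= restr_varsD; exact: clique_qmD.
- move=> s p; rewrite /clique_module/= restr_varsM expr2 restr_varsM -expr2.
  by apply: clique_qmM; exact: restr_vars_sub.
Qed.

(** For [i] in [C], adding the other squares to the ball constraint leaves [c - 'X_i ^+ 2]; the
    remaining variables restrict to 0. *)
Lemma clique_module_archi (j : 'I_k) (c : R) : j \in D ->
  g j = c%:MP - \sum_(i in C) 'X_i ^+ 2 -> archi_module clique_module.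
Proof.
move=> jD gj; apply: qm_archi; first exact: clique_module_quad.
have restrE i (b : R) : restr_vars C (b%:MP - 'X_i ^+ 2) =
    b%:MP - (if i \in C then 'X_i else 0) ^+ 2.
  by rewrite /restr_vars rmorphB/= rmorphXn/= comp_mpolyC [_ 'X_i]restr_varsXU.
move=> i; have [iC|iC] := boolP (i \in C); last first.
  exists 0; rewrite /clique_module/= restrE (negPf iC) expr0n/= subr0 mpolyC0.
  exact: clique_qm0.
exists c; rewrite /clique_module/= restrE iC.
have -> : c%:MP - 'X_i ^+ 2 = g j * 1 ^+ 2 + \sum_(a in C | a != i) 'X_a ^+ 2.
  by rewrite gj (bigD1 i)//= expr1n; ring.
constructor => //; first by rewrite -mpolyC1 vars_subC.
elim/big_ind: _ => [||a /andP[aC _]]; [exact: clique_qm0|exact: clique_qmD|].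
by rewrite -['X_a ^+ 2]addr0; constructor; [exact: vars_subX|exact: clique_qm0].
Qed.

Lemma clique_putinar (j : 'I_k) (c : R) h : j \in D ->
  g j = c%:MP - \sum_(i in C) 'X_i ^+ 2 ->
  (forall i, i \in D -> vars (g i) \subset C) -> vars h \subset C ->
  (forall a : 'I_n -> R, (forall i, i \in D -> 0 <= (g i).@[a]) -> 0 < h.@[a]) ->
  clique_qm h.
Proof.
move=> jD gj gC hC hpos; rewrite -(restr_vars_id hC).
apply: (putinar clique_module_quad (clique_module_archi jD gj)) => a ha.
apply: hpos => i iD; apply: ha; rewrite /clique_module/= restr_vars_id ?gC//.
rewrite -[g i]addr0 -[g i]mulr1 -(expr1n _ 2).
by constructor => //; [rewrite -mpolyC1 vars_subC|exact: clique_qm0].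
Qed.

End CliqueModule.

(** * Riesz functionals and moment matrices *)

Section Riesz.
Variables (R : realType) (n : nat).
Local Notation poly := {mpoly R[n]}.
Implicit Types (p q h s : poly) (y : 'X_{1..n} -> R) (C : {set 'I_n}).

Lemma riesz_wide y p (r : seq 'X_{1..n}) : uniq r -> {subset msupp p <= r} ->
  riesz y p = \sum_(m <- r) p@_m * y m.
Proof.
move=> ur pr; rewrite /riesz [RHS](bigID (mem (msupp p)))/= [X in _ + X]big1 ?addr0.
  rewrite -[RHS]big_filter; apply: perm_big; apply: uniq_perm.
  - exact: msupp_uniq.
  - exact: filter_uniq.
  - by move=> m; rewrite mem_filter; case mp: (m \in msupp p); rewrite //= pr.
by move=> m mp; rewrite memN_msupp_eq0// mul0r.
Qed.

Lemma rieszD y p q : riesz y (p + q) = riesz y p + riesz y q.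
Proof.
have u := undup_uniq (msupp p ++ msupp q).
rewrite !(riesz_wide y u); last first.
- by move=> m /msuppD_le; rewrite mem_undup.
- by move=> m mp; rewrite mem_undup mem_cat mp ?orbT.
- by move=> m mp; rewrite mem_undup mem_cat mp ?orbT.
by rewrite -big_split; apply: eq_bigr => m _; rewrite mcoeffD mulrDl.
Qed.

Lemma rieszZ y c p : riesz y (c *: p) = c * riesz y p.
Proof.
rewrite (riesz_wide y (msupp_uniq p)); last exact: msuppZ_le.
by rewrite mulr_sumr; apply: eq_bigr => m _; rewrite mcoeffZ mulrA.
Qed.

Lemma riesz0 y : riesz y 0 = 0.
Proof. by rewrite /riesz msupp0 big_nil. Qed.

Lemma riesz_sum y (I : Type) (r : seq I) (F : I -> poly) :
  riesz y (\sum_(i <- r) F i) = \sum_(i <- r) riesz y (F i).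
Proof. by elim/big_rec2: _ => [|i a b _ <-]; rewrite ?riesz0 ?rieszD. Qed.

Lemma riesz1 y : riesz y 1 = y 0%MM.
Proof. by rewrite /riesz msupp1 big_seq1 mcoeff1 eqxx mul1r. Qed.

Definition dirac_moments (a : 'I_n -> R) : 'X_{1..n} -> R :=
  fun m => \prod_(i < n) a i ^+ m i.

Lemma riesz_dirac a p : riesz (dirac_moments a) p = p.@[a].
Proof. by rewrite mevalE. Qed.

Lemma moment_mx_form e h y C (v : 'rV[R]_#|mons C e|) :
  (v *m moment_mx e h y C *m v^T) 0 0 =
  riesz y (h * (\sum_i v 0 i *: 'X_[mon_val (enum_val i)]) ^+ 2).
Proof.
rewrite expr2 mulrA !mulr_sumr riesz_sum mxE; apply: eq_bigr => j _.
rewrite !mxE !mulr_suml riesz_sum; apply: eq_bigr => i _.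
rewrite mxE; set X := 'X_[_]; set Y := 'X_[_].
have -> : h * (v 0 i *: X) * (v 0 j *: Y) = (v 0 i * v 0 j) *: (h * X * Y).
  by rewrite -!mul_mpolyC mpolyCM; ring.
by rewrite rieszZ; ring.
Qed.

Lemma moment_mx_sym e h y C : (moment_mx e h y C)^T = moment_mx e h y C.
Proof. by apply/matrixP => i j; rewrite !mxE mulrAC. Qed.

Lemma mons_decomp e C s : vars s \subset C -> (msize s <= e.+1)%N ->
  s = \sum_(i < #|mons C e|) s@_(mon_val (enum_val i)) *: 'X_[mon_val (enum_val i)].
Proof.
move=> /vars_subP sC se; apply/mpolyP => m.
rewrite (raddf_sum (mcoeff m))/=.
under eq_bigr do rewrite mcoeffZ mcoeffX.
have [ms|ms] := boolP (m \in msupp s); last first.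
  rewrite (memN_msupp_eq0 ms) big1// => i _; case: eqVneq => [->|_].
    by rewrite (memN_msupp_eq0 ms) mul0r.
  by rewrite mulr0.
have me : (mdeg m < e.+1)%N by apply: leq_trans (msize_mdeg_lt ms) se.
pose b : mons C e := exist _ (BMultinom me) (sC _ ms).
rewrite (bigD1 (enum_rank b))//= enum_rankK eqxx mulr1 big1 ?addr0// => i ib.
case: eqVneq => [im|_]; last by rewrite mulr0.
case/eqP: ib; rewrite -(enum_valK i); congr enum_rank.
by apply/val_inj/val_inj.
Qed.

(** A vector indexed by [mons C e] is the coefficient vector of a polynomial [s] of degree at most
    [e] in the variables of [C], and the quadratic form at it is the functional at [h s^2]. *)
Lemma psd_moment_mxP e h y C : psd_cone (moment_mx e h y C) <->
  forall s, vars s \subset C -> (msize s <= e.+1)%N -> 0 <= riesz y (h * s ^+ 2).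
Proof.
split=> [[_ hM] s sC se|hM].
  have := hM (\row_i s@_(mon_val (enum_val i))); rewrite moment_mx_form.
  rewrite [in X in _ -> X](mons_decomp sC se).
  by under [X in 0 <= riesz _ (_ * X ^+ 2) -> _]eq_bigr do rewrite mxE.
split=> [|v]; first exact: moment_mx_sym.
rewrite moment_mx_form; apply: hM.
  apply: vars_sub_sum => i _; rewrite -mul_mpolyC vars_subM ?vars_subC//.
  apply/vars_subP => m; rewrite msuppX inE => /eqP ->.
  by case: (enum_val i).
rewrite msizeE; apply/bigmax_leqP_seq => m + _; move=> /msupp_sum_le/flattenP[_ /mapP[i _ ->]] /msuppZ_le.
rewrite msuppX inE => /eqP ->.
exact: bmdeg.
Qed.

End Riesz.

(** * Term sparsity *)

Section GraphProjection.
Variables (R : realType) (T : finType).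

(** Nodes with the same component root form a diagonal block, so the form of the projection at [v]
    is the sum of the forms of [Q] at the restrictions of [v] to the components. *)
Lemma psd_graph_proj (e : rel T) (Q : 'M[R]_#|T|) : connect_sym e ->
  psd_cone Q -> psd_cone (graph_proj (max_chordal_ext e) Q).
Proof.
move=> esym [Qsym Qpos].
have adjE (i j : 'I_#|T|) : (i == j) || max_chordal_ext e (enum_val i) (enum_val j) =
    connect e (enum_val i) (enum_val j).
  rewrite /max_chordal_ext/= (inj_eq enum_val_inj).
  by case: eqVneq => // ->; rewrite connect0.
split=> [|v].
  apply/matrixP => i j; rewrite !mxE !adjE esym; case: ifP => // _.
  by rewrite -{1}Qsym mxE.
pose w r : 'rV[R]_#|T| := \row_i (if fingraph.root e (enum_val i) == r then v 0 i else 0).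
suff -> : (v *m graph_proj (max_chordal_ext e) Q *m v^T) 0 0 =
    \sum_(r : T) (w r *m Q *m (w r)^T) 0 0 by apply: sumr_ge0.
rewrite mxE; under [RHS]eq_bigr do rewrite mxE.
rewrite exchange_big/=; apply: eq_bigr => j _.
rewrite (bigD1 (fingraph.root e (enum_val j)))//= [X in _ + X]big1 ?addr0; last first.
  by move=> r jr; rewrite !mxE eq_sym (negPf jr) mulr0.
rewrite !mxE eqxx; congr (_ * _); apply: eq_bigr => i _.
rewrite !mxE adjE -(root_connect esym); case: eqVneq => _ //.
by rewrite mulr0 mul0r.
Qed.

End GraphProjection.

(** * Stabilization of the graphs and exactness of the stable relaxation *)

Section TermSparsity.
Variables (R : realType) (n m p : nat).
Variables (f : {mpoly R[n]}) (g : 'I_m -> {mpoly R[n]}).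
Variables (I : 'I_p -> {set 'I_n}) (J : 'I_p -> {set 'I_m}) (d : nat).
Local Notation graphs := (ts_graphs g I d).
Local Notation G k := (@ts_graph R n m p f g I J d k).
Local Notation ext E := (@supp_extension R n m p g I J d E).
Implicit Types (E F : graphs).

Definition subgraphs E F := forall l j, subrel (E l j) (F l j).

Lemma joint_supp_mono E F : subgraphs E F -> joint_supp J E `<=` joint_supp J F.
Proof.
move=> EF a [l _ [j Jlj [b gb [c [b1 [b2 [bE cE]]] abc]]]].
exists l => //; exists j => //; exists b => //; exists c => //.
by exists b1, b2; split => //; case: bE => [->|/EF]; [left|right].
Qed.

Lemma supp_extension_mono E F : subgraphs E F ->
  subgraphs (ext E) (ext F).
Proof.
move=> EF l j b c /andP[bc /asboolP[a [ha hE]]]; apply/andP; split => //.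
by apply/asboolP; exists a; split => //; exact: joint_supp_mono hE.
Qed.

Lemma max_chordal_ext_mono (T : finType) (e e' : rel T) : subrel e e' ->
  subrel (max_chordal_ext e) (max_chordal_ext e').
Proof.
move=> ee x y /andP[xy cxy]; apply/andP; split => //; apply: connect_sub cxy => a b ab.
exact/connect1/ee.
Qed.

Lemma mem_pol_supp_g0 : pol_supp (g_ g None) 0%MM.
Proof. by rewrite /pol_supp/= msupp1 inE. Qed.

Lemma joint_supp0 E l (b c : ts_nodes g I d l None) : b = c \/ E l None b c ->
  joint_supp J E (mon_val b + mon_val c)%MM.
Proof.
move=> bE; exists l => //; exists None => //; exists 0%MM; first exact: mem_pol_supp_g0.
by exists (mon_val b + mon_val c)%MM; [exists b, c|rewrite add0m].
Qed.

(** An initial edge contributes the sum of its ends to the joint support, which makes it an edge at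
    the next step since [g_0 = 1]; later steps follow by monotonicity. *)
Lemma ts_graph_step k : subgraphs (G k) (G k.+1).
Proof.
elim: k => [|k IH] l j b c.
  case: j b c => [//|] b c /=; rewrite /init_graph => h.
  have /andP[bc _] := h; apply/andP; split => //; apply: connect1; apply/andP; split => //.
  apply/asboolP; exists (mon_val b + mon_val c)%MM; split.
    by exists (mon_val b + mon_val c)%MM => //; exists 0%MM; [exact: mem_pol_supp_g0|rewrite addm0].
  by apply: joint_supp0; right.
by apply: max_chordal_ext_mono; exact: supp_extension_mono.
Qed.

Lemma ts_graph_mono k k' : (k <= k')%N -> subgraphs (G k) (G k').
Proof.
move=> kk; rewrite -(subnKC kk); elim: (k' - k)%N => [|i IH]; first by rewrite addn0 => l j.
by rewrite addnS => l j b c /IH; exact: ts_graph_step.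
Qed.

Let edge_type : finType :=
  {l : 'I_p & {j : option 'I_m & (ts_nodes g I d l j * ts_nodes g I d l j)%type}}.

Let edges E : {set edge_type} :=
  [set x | E (tag x) (tag (tagged x)) (tagged (tagged x)).1 (tagged (tagged x)).2]%SET.

(** Every strict step enlarges a subset of the finite type of all potential edges, so some step adds
    nothing, and by monotonicity neither do the following ones. *)
Lemma ts_graph_stable : exists k0, forall k, (k0 <= k)%N -> subgraphs (G k.+1) (G k).
Proof.
have [k0 hk0] : exists k0, subgraphs (G k0.+1) (G k0).
  apply: contrapT => nk.
  have card k : (k <= #|edges (G k)|)%N.
    elim: k => // k IH; apply: (leq_ltn_trans IH); apply: proper_card.
    rewrite properE; apply/andP; split.
      by apply/fintype.subsetP => x; rewrite !inE; exact: ts_graph_step.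
    apply/negP => /fintype.subsetP sub; apply: nk; exists k => l j b c bc.
    have := sub (existT _ l (existT _ j (b, c))); rewrite !inE; exact.
  have := card #|edge_type|.+1; rewrite leqNgt ltnS => /negP; apply.
  exact: max_card.
exists k0 => k; elim: k => [|k IH]; first by rewrite leqn0 => /eqP <-.
rewrite leq_eqVlt => /orP[/eqP <- //|]; rewrite ltnS => /IH hk l j.
by apply: max_chordal_ext_mono; exact: supp_extension_mono.
Qed.

Lemma half_deg1 : half_deg (1 : {mpoly R[n]}) = 0%N.
Proof. by rewrite /half_deg msize1. Qed.

Lemma cs_feasible_psd y l j : cs_feasible g I J d y -> J_ J l j ->
  psd_cone (moment_mx (d - half_deg (g_ g j)) (g_ g j) y (I l)).
Proof.
move=> [h0 hJ _]; case: j => [j|] /= Jlj; first exact: hJ.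
by rewrite half_deg1 subn0.
Qed.

Lemma psd_cs_feasible y :
  (forall l j, J_ J l j -> psd_cone (moment_mx (d - half_deg (g_ g j)) (g_ g j) y (I l))) ->
  y 0%MM = 1 -> cs_feasible g I J d y.
Proof.
move=> h y0; split=> // [l|l j lj]; last exact: (h l (Some j)).
by have := h l None isT; rewrite /= half_deg1 subn0.
Qed.

(** The full moment matrix is itself a positive semidefinite completion of its masked version. *)
Lemma csts_opt_le k : (csts_opt f g I J d k <= cs_opt f g I J d)%E.
Proof.
apply: ereal_inf_le_tmp => _ [y fy <-]; exists y => //; split; last by case: fy.
move=> l j Jlj /=; exists (moment_mx (d - half_deg (g_ g j)) (g_ g j) y (I l)).
  exact: cs_feasible_psd.
apply/matrixP => i i'; rewrite /hadamard !mxE.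
by case: ifP => _; rewrite ?mul1r ?mul0r.
Qed.

Lemma rieszXX (y : 'X_{1..n} -> R) (h : {mpoly R[n]}) b c :
  riesz y (h * 'X_[b] * 'X_[c]) = \sum_(a <- msupp h) h@_a * y (b + c + a)%MM.
Proof.
rewrite {1}[h]mpolyE !mulr_suml riesz_sum; apply: eq_bigr => a _.
rewrite -!scalerAl rieszZ -!mpolyXD /riesz msuppX big_seq1 mcoeffX eqxx mul1r.
by rewrite -addmA addmC.
Qed.

Lemma supp_extension_sym E l j : connect_sym (@supp_extension _ _ _ _ g I J d E l j).
Proof. by apply: sym_connect_sym => b c; rewrite /supp_extension eq_sym addmC. Qed.

Definition truncate_moments (S : set 'X_{1..n}) (y : 'X_{1..n} -> R) : 'X_{1..n} -> R :=
  fun a => if `[< S a >] then y a else 0.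

(* At a stable step k, an edge of G^(k) has all its moments inside the joint
   support, and a non-edge has none of them there. *)
Lemma truncate_feasible y k : (0 < k)%N -> subgraphs (G k.+1) (G k) -> 'I_p ->
  csts_feasible f g I J d k y ->
  cs_feasible g I J d (truncate_moments (joint_supp J (G k)) y).
Proof.
case: k => // k _ stab l [hy y0]; set S := joint_supp J _.
apply: psd_cs_feasible; last first.
  rewrite /truncate_moments; case: asboolP => // -[].
  (* The moment at 0 survives the truncation, being the diagonal sum of the node 0 of the given
     clique. *)
  have h0 : (mdeg (0%MM : 'X_{1..n}) < (d - half_deg (g_ g None)).+1)%N by rewrite mdeg0.
  have h1 : mon_supp (0%MM : 'X_{1..n}) \subset I l.
    by apply/fintype.subsetP => i; rewrite inE mnm0E.
  pose b : ts_nodes g I d l None := exist _ (BMultinom h0) h1.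
  have -> : 0%MM = (mon_val b + mon_val b)%MM by exact: (esym (addm0 0%MM)).
  by apply: joint_supp0; left.
move=> {}l j Jlj; have [Q psdQ QE] := hy l j Jlj.
have -> : moment_mx (d - half_deg (g_ g j)) (g_ g j) (truncate_moments S y) (I l) =
    graph_proj (@ts_graph R n m p f g I J d k.+1 l j) Q.
  rewrite QE; apply/matrixP => i i'; rewrite /hadamard !mxE !rieszXX.
  set b := enum_val i; set c := enum_val i'.
  have [bc|nbc] := boolP ((i == i') || @ts_graph R n m p f g I J d k.+1 l j b c).
    rewrite mul1r; apply: eq_big_seq => a ag; congr (_ * _).
    rewrite /truncate_moments; case: asboolP => // -[].
    exists l => //; exists j => //; exists a => //.
    exists (mon_val b + mon_val c)%MM; last by rewrite addmC.
    exists b, c; split => //; move: bc => /orP[/eqP ii|]; last by right.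
    by left; rewrite /b ii.
  rewrite mul0r big_seq big1// => a ag; rewrite /truncate_moments.
  case: asboolP => Sa; last by rewrite mulr0.
  (* A surviving moment at a non-edge would create the edge at the next step, hence by stability it
     would already be there. *)
  move: nbc; rewrite negb_or => /andP[ii /negP[]]; apply: stab.
  have bc : b != c by rewrite (inj_eq enum_val_inj).
  apply/andP; split => //; apply: connect1; apply/andP; split => //; apply/asboolP.
  exists (mon_val b + mon_val c + a)%MM; split => //.
  by exists (mon_val b + mon_val c)%MM => //; exists a.
by apply: psd_graph_proj => //; exact: supp_extension_sym.
Qed.

Lemma submonomial (a : 'X_{1..n}) i : (i <= mdeg a)%N ->
  exists b : 'X_{1..n}, (b <= a)%MM /\ mdeg b = i.
Proof.
elim: i => [|i IH] ia; first by exists 0%MM; rewrite mdeg0 ; split => //; apply/mnm_lepP => z; rewrite mnm0E.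
have [b [ba bi]] := IH (ltnW ia).
have [x bx] : exists x, (b x < a x)%N.
  apply/existsP; apply: contraT; rewrite negb_exists => /forallP h.
  have : (mdeg a <= mdeg b)%N.
    by rewrite !mdegE; apply: leq_sum => x _; rewrite leqNgt.
  by rewrite bi leqNgt ia.
exists (b + U_(x))%MM; split; last by rewrite mdegD mdeg1 bi addn1.
apply/mnm_lepP => z; rewrite mnmDE mnm1E.
case: eqVneq => [<-|_]; first by rewrite addn1.
by rewrite addn0; exact: (mnm_lepP ba).
Qed.

(** A monomial of [f] has degree at most [2 d], so it splits into two factors of degree at most [d]
    in the same variables; these are equal or joined by an edge of the initial graph. *)
Lemma supp_joint k a : (half_deg f <= d)%N -> a \in msupp f ->
  (exists l, mon_supp a \subset I l) -> joint_supp J (G k) a.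
Proof.
move=> fd af [l al]; apply: (joint_supp_mono (ts_graph_mono (leq0n k))).
have a2d : (mdeg a <= d + d)%N.
  have h1 := msize_mdeg_lt af; move: fd; rewrite /half_deg.
  by rewrite leq_uphalf_double -addnn; apply: leq_trans; rewrite -ltnS (ltn_predK h1).
have [b [ba bd]] := submonomial (geq_minr d (mdeg a)).
have abc : a = (b + (a - b))%MM by rewrite addmC submK.
have bd' : (mdeg b <= d)%N by rewrite bd geq_minl.
have cd' : (mdeg (a - b)%MM <= d)%N.
  by have := congr1 mdeg abc; rewrite mdegD bd; lia.
have sub h : (h <= a)%MM -> mon_supp h \subset I l.
  move=> ha; apply: fintype.subset_trans al; apply/fintype.subsetP => i; rewrite !inE.
  by apply: contra => /eqP ai; rewrite -leqn0 -ai; exact: (mnm_lepP ha).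
have ex h : (h <= a)%MM -> (mdeg h <= d)%N -> exists v : ts_nodes g I d l None, mon_val v = h.
  move=> ha hd; have hd' : (mdeg h < (d - half_deg (g_ g None)).+1)%N.
    by rewrite /= half_deg1 subn0.
  by exists (exist _ (BMultinom hd') (sub _ ha)).
have ca : (a - b <= a)%MM by apply/mnm_lepP => i; rewrite mnmBE leq_subr.
have [vb vbE] := ex _ ba bd'; have [vc vcE] := ex _ ca cd'.
rewrite abc -vcE -vbE; apply: joint_supp0.
have [->|bc] := eqVneq vb vc; [by left|right].
rewrite /= /init_graph bc /=; apply/asboolP; left; rewrite vbE vcE -abc.
by split => //; left.
Qed.

(** Truncation makes a feasible point of the term-sparse problem feasible for the other one, with
    the same objective because the joint support contains that of [f]. *)
Lemma csts_opt_stabilizes : 'I_p -> (half_deg f <= d)%N ->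
  (forall a, a \in msupp f -> exists l, mon_supp a \subset I l) ->
  exists k0, (1 <= k0)%N /\ forall k, (k0 <= k)%N ->
    csts_opt f g I J d k = cs_opt f g I J d.
Proof.
move=> l fd fI; have [k0 hk0] := ts_graph_stable.
exists k0.+1; split => // k kk; apply/eqP; rewrite eq_le csts_opt_le /=.
apply: le_ereal_inf_tmp => _ [y yf <-].
have k_gt0 : (0 < k)%N by apply: leq_trans kk.
have fy := truncate_feasible k_gt0 (hk0 _ (ltnW kk)) l yf.
apply: ge_ereal_inf; eexists; first by exists (truncate_moments (joint_supp J (G k)) y).
rewrite lee_fin le_eqVlt; apply/orP; left; apply/eqP.
apply: eq_big_seq => a af; congr (_ * _); rewrite /truncate_moments.
by case: asboolP => // -[]; apply: supp_joint => //; exact: fI.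
Qed.

End TermSparsity.

(** * Convergence of the correlative sparsity hierarchy *)

Section Convergence.
Variables (R : realType) (n m p : nat).
Variables (f : {mpoly R[n]}) (g : 'I_m -> {mpoly R[n]}) (M : R).
Hypothesis M_gt0 : 0 < M.
Hypothesis K_bounded : forall x : 'rV[R]_n, feasible_set g x -> `|x| < M.
Variables (H : rel 'I_n) (I : 'I_p -> {set 'I_n}) (J : 'I_p -> {set 'I_(m + p)}).
Hypothesis H_ext : chordal_extension (csp_graph f g) H.
Hypothesis I_cliques : enum_max_cliques H I.
Local Notation g' := (add_ball_constraints g I M).
Hypothesis J_assign : constraint_assignment I g' J.

Lemma ball_constraintE l :
  g' (rshift m l) = (#|I l|%:R * M ^+ 2)%:MP - \sum_(i in I l) 'X_i ^+ 2.
Proof. by rewrite /add_ball_constraints (unsplitK (inr l)). Qed.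

Lemma add_ball_constraints_lshift k : g' (lshift p k) = g k.
Proof. by rewrite /add_ball_constraints (unsplitK (inl k)). Qed.

Lemma meval_ball l (a : 'I_n -> R) :
  (g' (rshift m l)).@[a] = #|I l|%:R * M ^+ 2 - \sum_(i in I l) a i ^+ 2.
Proof.
rewrite ball_constraintE mevalD mevalC mevalN; congr (_ - _).
by rewrite (raddf_sum (meval a)); apply: eq_bigr => i _; rewrite /= rmorphXn /= mevalXU.
Qed.

Lemma maximal_clique l : maxset (clique H) (I l).
Proof. by apply/I_cliques.2; exists l. Qed.

Lemma clique_I l : clique H (I l).
Proof. by have /maxsetP[] := maximal_clique l. Qed.

Lemma clique_sub_I C : clique H C -> exists l, C \subset I l.
Proof.
move=> cC; have [A maxA CA] := maxset_exists cC.
by have [l AI] := (I_cliques.2 A).1 maxA; exists l; rewrite -AI.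
Qed.

Lemma I_subset l l' : I l \subset I l' -> l = l'.
Proof.
move=> ll; have /maxsetP[_ maxl] := maximal_clique l.
by apply: I_cliques.1; rewrite (maxl _ (clique_I l') ll).
Qed.

(** If a variable of [I l] did not occur, the values at 0 and at its unit vector would agree, but
    they differ by 1. *)
Lemma ball_vars l : I l \subset vars (g' (rshift m l)).
Proof.
apply/fintype.subsetP => i iI; apply: contraT => iv.
have := @meval_vars _ _ (g' (rshift m l)) _ (fun _ => 0) (fun k => (k == i)%:R) (subxx _).
rewrite !meval_ball big1 => [|k _]; last by rewrite expr0n.
rewrite (bigD1 i)//= eqxx expr1n big1 => [|k /andP[_ /negPf ->]]; last by rewrite expr0n.
move=> h; have : 1 = 0 :> R.
  have := h _; rewrite subr0 addr0 => {}h; suff : #|I l|%:R * M ^+ 2 = #|I l|%:R * M ^+ 2 - 1 by lra.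
  by apply: h => k kv; case: eqVneq => // ki; rewrite ki (negPf iv) in kv.
by move/eqP; rewrite oner_eq0.
Qed.

(** The variables of this constraint fill the maximal clique [I l], which leaves only one class for
    it. *)
Lemma ball_assigned l : rshift m l \in J l.
Proof.
have [_ Jcov Jvars] := J_assign; have [l' ll'] := Jcov (rshift m l).
suff /I_subset e : I l \subset I l' by rewrite {2}e.
exact: fintype.subset_trans (ball_vars l) (Jvars _ _ ll').
Qed.

Definition eventually_nonneg (h : {mpoly R[n]}) : Prop :=
  exists d0, forall d, (d0 <= d)%N -> forall y, cs_feasible g' I J d y -> 0 <= riesz y h.

Lemma eventually_nonnegD h1 h2 :
  eventually_nonneg h1 -> eventually_nonneg h2 -> eventually_nonneg (h1 + h2).
Proof.
move=> [d1 H1] [d2 H2]; exists (maxn d1 d2) => d; rewrite geq_max => /andP[dd1 dd2] y yf.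
by rewrite rieszD addr_ge0 ?(H1 d)// (H2 d).
Qed.

(** Once the order exceeds the degrees of the finitely many multipliers, each term is a value of the
    quadratic form of a positive semidefinite moment matrix. *)
Lemma clique_qm_nonneg l h : clique_qm g' (I l) (J l) h -> eventually_nonneg h.
Proof.
elim=> [|s q sI _ [d0 IH]|j s q jJ sI _ [d0 IH]].
- by exists 0%N => d _ y _; rewrite riesz0.
- exists (maxn d0 (msize s)) => d; rewrite geq_max => /andP[dd0 ds] y yf.
  rewrite rieszD addr_ge0 ?(IH d)//; have [/(_ l)/psd_moment_mxP h0 _ _] := yf.
  by rewrite -[s ^+ 2]mul1r h0// (leq_trans ds).
- exists (maxn d0 (msize s + half_deg (g' j))) => d; rewrite geq_max => /andP[dd0 ds] y yf.
  rewrite rieszD addr_ge0 ?(IH d)//; have [_ /(_ l j jJ)/psd_moment_mxP h0 _] := yf.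
  by apply: h0 => //; apply: leqW; rewrite leq_subRL ?[(half_deg _ + _)%N]addnC//; lia.
Qed.

(** A coarse radius: [n_l M^2] is at most [((n + 1) M)^2]. *)
Let N : R := n.+1%:R * M.

Lemma ball_box l (a : 'I_n -> R) : 0 <= (g' (rshift m l)).@[a] ->
  forall i, i \in I l -> `|a i| <= N.
Proof.
rewrite meval_ball subr_ge0 => h i iI.
have N0 : 0 <= N by rewrite mulr_ge0// ltW.
rewrite -(@ler_pXn2r _ 2) ?nnegrE// real_normK ?num_real//.
have : a i ^+ 2 <= \sum_(i in I l) a i ^+ 2.
  by rewrite (bigD1 i)//= lerDl sumr_ge0// => k _; exact: sqr_ge0.
move=> /le_trans/(_ h)/le_trans; apply; rewrite /N exprMn ler_pM2r ?exprn_gt0//.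
rewrite -natrX ler_nat; apply: leq_trans (max_card _) _; rewrite card_ord.
by rewrite expnS expn1; apply: leq_trans (leq_pmulr _ _).
Qed.

Lemma clique_nonneg (own : 'I_(m + p) -> 'I_p) C h : (forall j, j \in J (own j)) ->
  clique H C -> vars h \subset C ->
  (forall x, local_feasible N g' (I \o own) C x -> 0 < h.@[x 0]) -> eventually_nonneg h.
Proof.
move=> ownJ cC hC hpos; have [l Cl] := clique_sub_I cC.
have [_ _ Jvars] := J_assign.
have hl : vars h \subset I l := fintype.subset_trans hC Cl.
apply: (@clique_qm_nonneg l).
apply: (clique_putinar (ball_assigned l) (ball_constraintE l)) => // [j jJ|a ha].
  exact: Jvars.
(* Zeros outside [I l] put the point in the box without changing the values of polynomials in the
   variables of [I l]. *)
pose x : 'rV[R]_n := \row_i (if i \in I l then a i else 0).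
have xa q : vars q \subset I l -> q.@[x 0] = q.@[a].
  by move=> ql; apply: (meval_vars ql) => i il; rewrite mxE il.
rewrite -xa//; apply: hpos; split=> [i|j /= jC].
  rewrite mxE; case: ifP => il; last by rewrite normr0 mulr_ge0// ltW.
  by apply: (ball_box (ha _ (ball_assigned l))).
(* The maximal clique owning [j] lies in [C], hence in [I l], and so equals it. *)
have jl : own j = l by apply: I_subset; exact: fintype.subset_trans Cl.
have jJ : j \in J l by rewrite -jl.
by rewrite xa ?ha//; exact: Jvars.
Qed.

Lemma clique_mon_supp a : a \in msupp f -> clique H (mon_supp a).
Proof.
move=> af; have [_ _ sub] := H_ext; apply/cliqueP => i j; rewrite !inE => ai aj ij.
apply: sub; rewrite /csp_graph/= ij; apply/orP; left; apply/hasP; exists a => //.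
by rewrite !lt0n ai.
Qed.

(** On the full vertex set every constraint is imposed, so [f - c] is positive on the local feasible
    set. Since [y] is 1 at 0, nonnegativity at [f - c] is the bound [c]. *)
Lemma cs_opt_lower (c : R) : (c%:E < global_opt f g)%E ->
  exists d0, forall d, (d0 <= d)%N -> (c%:E <= cs_opt f g' I J d)%E.
Proof.
move=> cG; have [e_simple e_chordal _] := H_ext; have [_ Jcov Jvars] := J_assign.
have [own ownJ] := choice Jcov.
have [d0 hd0] : eventually_nonneg (f - c%:MP).
  apply: (@sparse_positivity R n _ H N g' (I \o own) e_simple e_chordal _ _ _ _ _ [set: 'I_n]%SET).
  - by move=> j; exact: clique_I.
  - by move=> j; exact: Jvars.
  - exact: eventually_nonnegD.
  - by move=> C h; exact: clique_nonneg ownJ.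
  - move=> a; rewrite -mpolyCN => /msuppD_le; rewrite mem_cat => /orP[af|].
      by split; [exact: finset.subsetT|exact: clique_mon_supp].
    rewrite msuppC; case: ifP => // _; rewrite inE => /eqP ->.
    by split; [exact: finset.subsetT|apply/cliqueP => i j; rewrite inE mnm0E].
  - move=> x [_ hx]; rewrite mevalD mevalN mevalC subr_gt0 -lte_fin.
    apply: (lt_le_trans cG); apply: ereal_inf_lbound; exists x => // k.
    by have := hx (lshift p k) (finset.subsetT _); rewrite add_ball_constraints_lshift.
exists d0 => d dd; apply: le_ereal_inf_tmp => _ [y yf <-].
have := hd0 d dd y yf; have -> : f - c%:MP = f + (- c) *: 1.
  by rewrite -mul_mpolyC mulr1 mpolyCN.
rewrite rieszD rieszZ riesz1; case: yf => _ _ ->.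
by rewrite lee_fin; lra.
Qed.

(** The monomial values at a point of [K] form a feasible sequence; the ball constraints hold
    because all coordinates are at most [M] in absolute value. *)
Lemma cs_opt_upper d : (cs_opt f g' I J d <= global_opt f g)%E.
Proof.
apply: le_ereal_inf_tmp => _ [x xK <-].
apply: ge_ereal_inf; exists (f.@[x 0])%:E => //.
exists (dirac_moments (x 0)); last by rewrite riesz_dirac.
have psd e h l : 0 <= h.@[x 0] -> psd_cone (moment_mx e h (dirac_moments (x 0)) (I l)).
  move=> h0; apply/psd_moment_mxP => s _ _.
  by rewrite riesz_dirac mevalM rmorphXn /= mulr_ge0// sqr_ge0.
split=> [l|l j _|].
- by apply: psd; rewrite meval1.
- apply: psd; case: (split_ordP j) => k ->; first by rewrite add_ball_constraints_lshift.
  rewrite meval_ball subr_ge0 mulr_natl -sumr_const; apply: ler_sum => i _.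
  rewrite -real_normK ?num_real// ler_pXn2r ?nnegrE ?(ltW M_gt0)//.
  apply: le_trans (ltW (K_bounded xK)).
  rewrite /Num.Def.normr/= mx_normrE.
  exact: (le_bigmax _ (fun ij => `|x ij.1 ij.2|) (0, i)).
- by rewrite -riesz1 riesz_dirac meval1.
Qed.

Lemma cs_opt_cvg : (fun d => cs_opt f g' I J d) @ \oo --> global_opt f g.
Proof.
have near_ge (c : R) : (c%:E < global_opt f g)%E ->
    \forall d \near \oo, (c%:E <= cs_opt f g' I J d)%E.
  by move=> /cs_opt_lower[d0 hd0]; exists d0.
have := cs_opt_upper; case: (global_opt f g) near_ge => [r| |] near_ge upper.
- apply/fine_cvgP; split.
    have := near_ge (r - 1); rewrite lte_fin => /(_ ltac:(lra)).
    apply: filterS => d hd; rewrite fin_numElt.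
    by rewrite (lt_le_trans _ hd) ?ltNyr//= (le_lt_trans (upper d)) ?ltry.
  apply/cvgrPdist_le => e e0; have := near_ge (r - e); rewrite lte_fin => /(_ ltac:(lra)).
  apply: filterS => d; have := upper d; rewrite /=.
  case: (cs_opt f g' I J d) => [s| |]//; rewrite !lee_fin /= => h1 h2.
  by rewrite ger0_norm; lra.
(* The optimum is [+oo] exactly when [K] is empty. *)
- by apply/cvgeyPge => A; apply: near_ge; exact: ltry.
- rewrite (_ : (fun _ => _) = fun=> -oo%E); first exact: cvg_cst.
  by apply/funext => d; apply/eqP; rewrite -leeNy_eq.
Qed.

End Convergence.

Theorem mainTheorem2 (R : realType) (n m p : nat)
    (f : {mpoly R[n]}) (g : 'I_m -> {mpoly R[n]})
    (M : R) (M_gt0 : 0 < M)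
    (K_bounded : forall x : 'rV[R]_n, feasible_set g x -> `|x| < M)
    (H : rel 'I_n) (H_ext : chordal_extension (csp_graph f g) H)
    (I : 'I_p -> {set 'I_n}) (I_cliques : enum_max_cliques H I)
    (J : 'I_p -> {set 'I_(m + p)})
    (J_assign : constraint_assignment I (add_ball_constraints g I M) J) :
  let g' := add_ball_constraints g I M in
  (forall d : nat, (d_min f g' <= d)%N ->
     exists k0 : nat, (1 <= k0)%N /\
       forall k : nat, (k0 <= k)%N ->
         csts_opt f g' I J d k = cs_opt f g' I J d)
  /\ ((fun d : nat => cs_opt f g' I J d) @ \oo --> global_opt f g).
Proof.
split; last exact: cs_opt_cvg H_ext I_cliques J_assign.
move=> d; rewrite geq_max => /andP[fd _].
(* The empty clique extends to a maximal one, so at least one [I l] exists, even for [n = 0]. *)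
have [l _] : exists l, finset.set0 \subset I l.
  by apply: (clique_sub_I I_cliques); apply/cliqueP => x y; rewrite inE.
apply: csts_opt_stabilizes => // a af.
exact: (clique_sub_I I_cliques (clique_mon_supp H_ext af)).
Qed.
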